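(* Suppose that $\kappa_2\not\equiv\kappa_1-1\pmod e$ and $n\equiv\kappa_2-\kappa_1+1\pmod e$. Then, for all $m\in\{1,\dots,n-1\}$, the $\mathscr H_n^\Lambda$-module $S_{((n-m),(1^m))}$ has the composition series $$0\subset\operatorname{im}(\gamma_{m-1})\subset S_{((n-m),(1^m))},$$ where $S_{((n-m),(1^m))}/\operatorname{im}(\gamma_{m-1})\cong\operatorname{im}(\gamma_m)$.
   Context: Let $\mathbb F$ be a field, $e\geqslant 3$ an integer, $I=\mathbb Z/e\mathbb Z$, $n\geqslant 1$ an integer and $\kappa=(\kappa_1,\kappa_2)\in I^2$. For $i,j\in I$ write $i\to j$ if $j=i+1$ and $i\leftarrow j$ if $j=i-1$. The symmetric group $\mathfrak S_n$, with $s_r=(r,r+1)$, acts on $I^n$ by place permutations. Algebra. $\mathscr H_n$ is the unital associative $\mathbb F$-algebra with generators $e(\mathbf i)$ ($\mathbf i\in I^n$), $y_1,\dots,y_n$, $\psi_1,\dots,\psi_{n-1}$ and relations: $e(\mathbf i)e(\mathbf j)=\delta_{\mathbf i,\mathbf j}e(\mathbf i)$; $\sum_{\mathbf i}e(\mathbf i)=1$; $y_re(\mathbf i)=e(\mathbf i)y_r$; $\psi_re(\mathbf i)=e(s_r\mathbf i)\psi_r$; $y_ry_s=y_sy_r$; $\psi_ry_s=y_s\psi_r$ if $s\ne r,r+1$; $\psi_r\psi_s=\psi_s\psi_r$ if $|r-s|>1$; $\psi_ry_{r+1}e(\mathbf i)=(y_r\psi_r+\delta_{i_r,i_{r+1}})e(\mathbf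 i)$; $y_{r+1}\psi_re(\mathbf i)=(\psi_ry_r+\delta_{i_r,i_{r+1}})e(\mathbf i)$; $\psi_r^2e(\mathbf i)$ equals $0$ if $i_r=i_{r+1}$, $(y_{r+1}-y_r)e(\mathbf i)$ if $i_r\to i_{r+1}$, $(y_r-y_{r+1})e(\mathbf i)$ if $i_r\leftarrow i_{r+1}$, and $e(\mathbf i)$ otherwise; $\psi_r\psi_{r+1}\psi_re(\mathbf i)$ equals $(\psi_{r+1}\psi_r\psi_{r+1}+1)e(\mathbf i)$ if $i_{r+2}=i_r\to i_{r+1}$, $(\psi_{r+1}\psi_r\psi_{r+1}-1)e(\mathbf i)$ if $i_{r+2}=i_r\leftarrow i_{r+1}$, and $\psi_{r+1}\psi_r\psi_{r+1}e(\mathbf i)$ otherwise. The cyclotomic algebra $\mathscr H_n^\Lambda$ (level 2) is the quotient of $\mathscr H_n$ by the relations $y_1^{c(i_1)}e(\mathbf i)=0$ for all $\mathbf i\in I^n$, where $c(i)=\#\{j\in\{1,2\}:\kappa_j=i\}$. Specht modules labelled by hook bipartitions. For $0\leqslant m\leqslant n$ put $\mathbf i_{((n-m),(1^m))}=(\kappa_2,\kappa_2-1,\dots,\kappa_2-m+1,\kappa_1,\kappa_1+1,\dots,\kappa_1+n-m-1)\in I^n$. The Specht module $S_{((n-m),(1^m))}$ is the module generated by $z=z_{((n-m),(1^m))}$ subject only to $e(\mathbf i_{((n-m),(1^m))})z=z$, $y_rz=0$ for $1\leqslant r\leqslant n$, and $\psi_rz=0$ for all $r\in\{1,\dots,n-1\}\setminus\{m\}$;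 it is an $\mathscr H_n^\Lambda$-module. For $1\leqslant a_1<\dots<a_m\leqslant n$ define $v(a_1,\dots,a_m)=(\psi_{a_1-1}\cdots\psi_1)(\psi_{a_2-1}\cdots\psi_2)\cdots(\psi_{a_m-1}\cdots\psi_m)z$ (indices decreasing in each factor; the factor is $1$ if $a_j=j$). These vectors form an $\mathbb F$-basis (the standard basis) of $S_{((n-m),(1^m))}$. Homomorphism. When $n\equiv\kappa_2-\kappa_1+1\pmod e$ and $0\leqslant m\leqslant n-1$, $\gamma_m:S_{((n-m),(1^m))}\to S_{((n-m-1),(1^{m+1}))}$ is the (well-defined) $\mathscr H_n^\Lambda$-homomorphism with $\gamma_m(z_{((n-m),(1^m))})=v(1,\dots,m,n)$. *)

(* Defs.v *)
From HB Require Import structures.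
From mathcomp Require Import all_boot all_order all_algebra.
From mathcomp Require Import perm.
From mathcomp Require Import boolp.
From mathcomp.multinomials Require Import monalg.

Set Implicit Arguments.
Unset Strict Implicit.
Unset Printing Implicit Defensive.

Import GRing.Theory.
Local Open Scope ring_scope.
Local Open Scope quotient_scope.

(* A bundled version of submodClosed, which, unlike the latter, also carries
   the zmodClosed structure expected by the library's quotients. *)
Record submodule (R : pzRingType) (V : lmodType R) := Submodule {
  submod_pred :> {pred V};
  submodP : GRing.submod_closed submod_pred
}.

HB.instance Definition _ (R : pzRingType) (V : lmodType R) (S : submodule V) :=
  GRing.isSubmodClosed.Build R V (submod_pred S) (submodP S).

Section SubmoduleType.
Variables (R : pzRingType) (V : lmodType R) (S : submodule V).

Definition submod_type : Type := {x : V | x \in S}.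
HB.instance Definition _ := SubType.on submod_type.
HB.instance Definition _ := [Choice of submod_type by <:].
HB.instance Definition _ := [SubChoice_isSubLmodule of submod_type by <:].

End SubmoduleType.

Section QuotientModule.
Variables (R : pzRingType) (V : lmodType R) (S : submodule V).

Definition quot_mod : Type := Quotient.quot S.
HB.instance Definition _ := Choice.on quot_mod.
HB.instance Definition _ := GRing.Zmodule.on quot_mod.
HB.instance Definition _ := EqQuotient.on quot_mod.

Lemma quot_modP (x y : V) : \pi_quot_mod x = \pi y <-> x - y \in S.
Proof.
split=> [/eqP|xy]; first by rewrite -(@Quotient.idealrBE V S).
by apply/eqP; rewrite -(@Quotient.idealrBE V S).
Qed.

Definition quot_scale (a : R) (x : quot_mod) : quot_mod :=
  \pi_quot_mod (a *: repr x).

Lemma pi_quotZ a (x : V) : quot_scale a (\pi_quot_mod x) = \pi_quot_mod (a *: x).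
Proof.
by apply/quot_modP; rewrite -scalerBr rpredZ //; apply/quot_modP; rewrite reprK.
Qed.

Lemma pi_quotD (x y : V) : \pi_quot_mod (x + y) = \pi x + \pi y.
Proof. exact: (@Quotient.pi_add V S). Qed.

Fact quot_scalerA a b x : quot_scale a (quot_scale b x) = quot_scale (a * b) x.
Proof. by rewrite -[x]reprK (pi_quotZ b) !pi_quotZ scalerA. Qed.
Fact quot_scale1r : left_id 1 quot_scale.
Proof. by move=> x; rewrite -[x]reprK pi_quotZ scale1r. Qed.
Fact quot_scalerDr : right_distributive quot_scale +%R.
Proof.
by move=> a x y; rewrite -[x]reprK -[y]reprK -pi_quotD !pi_quotZ scalerDr pi_quotD.
Qed.
Fact quot_scalerDl x : {morph quot_scale^~ x : a b / a + b}.
Proof. by move=> a b; rewrite -[x]reprK !pi_quotZ scalerDl pi_quotD. Qed.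

HB.instance Definition _ := GRing.Zmodule_isLmodule.Build R quot_mod
  quot_scalerA quot_scale1r quot_scalerDr quot_scalerDl.

End QuotientModule.

Section SubmoduleConstructions.
Variables (R : pzRingType) (V W : lmodType R).

Fact zero_submod_closed : GRing.submod_closed (pred1 (0 : V)).
Proof.
by split=> [|a x y]; rewrite !inE // => /eqP-> /eqP->; rewrite scaler0 addr0.
Qed.
Definition zero_submod : submodule V := Submodule zero_submod_closed.

Fact full_submod_closed : GRing.submod_closed (predT : {pred V}).
Proof. by []. Qed.
Definition full_submod : submodule V := Submodule full_submod_closed.

Fact im_submod_closed (f : {linear V -> W}) :
  GRing.submod_closed [pred y : W | `[< exists x, f x = y >]].
Proof.
split=> [|a x y]; rewrite !inE; first by apply/asboolP; exists 0; rewrite raddf0.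
move=> /asboolP[u <-] /asboolP[v <-]; apply/asboolP.
by exists (a *: u + v); rewrite linearP.
Qed.
Definition im_submod f : submodule W := Submodule (im_submod_closed f).

Fact trace_submod_closed (T U : submodule V) :
  GRing.submod_closed [pred x : submod_type T | val x \in U].
Proof.
split=> [|a x y]; rewrite !inE ?raddf0 ?rpred0 //.
by move=> Ux Uy; rewrite linearP rpredD ?rpredZ.
Qed.
(* T :&: U, seen as a submodule of T *)
Definition trace_submod T U : submodule (submod_type T) :=
  Submodule (trace_submod_closed T U).

End SubmoduleConstructions.
Arguments zero_submod {R} V.
Arguments full_submod {R} V.
Arguments trace_submod {R V} T U.

Definition simple_mod (R : pzRingType) (V : lmodType R) : Prop :=
  (exists x : V, x != 0) /\
  (forall U : submodule V, U =i zero_submod V \/ U =i full_submod V).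


(* Simplicity of T / (T :&: U), which is T / U when U is contained in T. *)
Definition simple_factor (R : pzRingType) (V : lmodType R)
    (T U : submodule V) : Prop :=
  simple_mod (quot_mod (trace_submod T U)).

(* [:: N_0; ...; N_k] with 0 = N_0 <= ... <= N_k = V and each N_(i+1) / N_i
   simple. *)
Definition composition_series (R : pzRingType) (V : lmodType R)
    (N : seq (submodule V)) : Prop :=
  [/\ head (full_submod V) N =i zero_submod V,
      last (zero_submod V) N =i full_submod V
    & forall i, i.+1 < size N ->
        let N_ := nth (zero_submod V) N in
        {subset N_ i <= N_ i.+1} /\ simple_factor (N_ i.+1) (N_ i)]%N.

Section Presentations.

Section GeneratedSubmodule.
Variables (R : pzRingType) (V : lmodType R) (X : V -> Prop).

Fact gen_submod_closed : GRing.submod_closed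
  [pred x : V | `[< forall U : submodule V,
                      (forall y, X y -> y \in U) -> x \in U >]].
Proof.
split=> [|a x y]; rewrite !inE; first by apply/asboolP=> U _; apply: rpred0.
move=> /asboolP Hx /asboolP Hy; apply/asboolP=> U XU.
by rewrite rpredD ?rpredZ ?Hx ?Hy.
Qed.
Definition gen_submod : submodule V := Submodule gen_submod_closed.

End GeneratedSubmodule.

Section PresentedAlgebra.
Variables (A : pzRingType) (rel : A -> A -> Prop).

(* The two-sided ideal generated by the differences l - r with rel l r. *)
Fact ideal_gen_closed : GRing.submod_closed
  [pred x : A^o | `[< forall J : submodule A^o,
     (forall y a : A, y \in J -> y * a \in J) ->
     (forall l r : A, rel l r -> l - r \in J) -> x \in J >]].
Proof.
split=> [|a x y]; rewrite !inE; first by apply/asboolP=> J _ _; apply: rpred0.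
move=> /asboolP Hx /asboolP Hy; apply/asboolP=> J Jr relJ.
by rewrite rpredD ?rpredZ ?Hx ?Hy.
Qed.
Definition ideal_gen : submodule A^o := Submodule ideal_gen_closed.

Fact ideal_genMr (x a : A) : x \in ideal_gen -> x * a \in ideal_gen.
Proof.
rewrite !inE => /asboolP Hx; apply/asboolP=> J Jr relJ.
by apply: (Jr); apply: Hx.
Qed.
Fact ideal_genMl (a x : A) : x \in ideal_gen -> a * x \in ideal_gen.
Proof. exact: (@rpredZ A A^o ideal_gen a x). Qed.

Definition presented_alg : Type := quot_mod ideal_gen.
HB.instance Definition _ := Choice.on presented_alg.
HB.instance Definition _ := GRing.Zmodule.on presented_alg.

Definition pi_alg (x : A) : presented_alg := \pi_(quot_mod ideal_gen) x.
Definition presented_mul (x y : presented_alg) : presented_alg :=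
  pi_alg (repr (x : quot_mod ideal_gen) * repr (y : quot_mod ideal_gen)).

Lemma pi_algP (x y : A) : pi_alg x = pi_alg y <-> x - y \in ideal_gen.
Proof. exact: quot_modP. Qed.

Fact pi_algK (x : presented_alg) : pi_alg (repr (x : quot_mod ideal_gen)) = x.
Proof. exact: reprK. Qed.
Fact pi_algD (x y : A) : pi_alg (x + y) = pi_alg x + pi_alg y.
Proof. exact: (@pi_quotD A A^o ideal_gen x y). Qed.

Fact pi_algM (x y : A) :
  pi_alg (x * y) = presented_mul (pi_alg x) (pi_alg y).
Proof.
apply/pi_algP; set x' := repr _; set y' := repr _.
have -> : x * y - x' * y' = (x - x') * y + x' * (y - y').
  by rewrite mulrBl mulrBr addrA subrK.
apply: (@rpredD A^o ideal_gen); [apply: ideal_genMr|apply: ideal_genMl].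
  by apply/pi_algP; rewrite pi_algK.
by apply/pi_algP; rewrite pi_algK.
Qed.

Fact presented_mulA : associative presented_mul.
Proof.
move=> x y z; rewrite -[x]pi_algK -[y]pi_algK -[z]pi_algK.
by rewrite -!pi_algM mulrA.
Qed.
Fact presented_mul1l : left_id (pi_alg 1) presented_mul.
Proof. by move=> x; rewrite -[x]pi_algK -pi_algM mul1r. Qed.
Fact presented_mul1r : right_id (pi_alg 1) presented_mul.
Proof. by move=> x; rewrite -[x]pi_algK -pi_algM mulr1. Qed.
Fact presented_mulDl : left_distributive presented_mul +%R.
Proof.
move=> x y z; rewrite -[x]pi_algK -[y]pi_algK -[z]pi_algK.
by rewrite -pi_algD -!pi_algM mulrDl pi_algD.
Qed.
Fact presented_mulDr : right_distributive presented_mul +%R.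
Proof.
move=> x y z; rewrite -[x]pi_algK -[y]pi_algK -[z]pi_algK.
by rewrite -pi_algD -!pi_algM mulrDr pi_algD.
Qed.

HB.instance Definition _ := GRing.Zmodule_isPzRing.Build presented_alg
  presented_mulA presented_mul1l presented_mul1r presented_mulDl presented_mulDr.

Fact pi_alg_zmod : zmod_morphism pi_alg.
Proof.
move=> x y; apply: (addIr (pi_alg y)).
by rewrite -pi_algD !subrK.
Qed.
HB.instance Definition _ :=
  GRing.isZmodMorphism.Build A presented_alg pi_alg pi_alg_zmod.
Fact pi_alg_monoid : monoid_morphism pi_alg.
Proof. by split=> // x y; apply: pi_algM. Qed.
HB.instance Definition _ :=
  GRing.isMonoidMorphism.Build A presented_alg pi_alg pi_alg_monoid.

End PresentedAlgebra.

(* The module generated by one element cyclic_gen subject to the relations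
   a *: cyclic_gen = 0 for all a with X a. *)
Section CyclicModule.
Variables (R : pzRingType) (X : R -> Prop).

Definition cyclic_mod : Type := quot_mod (gen_submod (X : R^o -> Prop)).
HB.instance Definition _ := GRing.Lmodule.on cyclic_mod.
Definition cyclic_gen : cyclic_mod :=
  \pi_(quot_mod (gen_submod (X : R^o -> Prop))) 1.

End CyclicModule.

End Presentations.

Section KLR.
Variables (F : fieldType) (e n : nat).

Local Notation res_seq := {ffun 'I_n -> 'Z_e}.

(* Positions are numbered from 0: a residue sequence i has entries
   i 0, ..., i (n - 1), and psi r, for r < n - 1, is attached to the positions
   lo r = r and hi r = r + 1.  Thus y r, psi r, lo r and hi r are
   y_(r+1), psi_(r+1), r + 1 and r + 2 in the numbering from 1. *)
Fact hi_subproof (r : 'I_n.-1) : (r.+1 < n)%N.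
Proof. by rewrite -ltn_predRL. Qed.
Definition lo (r : 'I_n.-1) : 'I_n := widen_ord (leq_pred n) r.
Definition hi (r : 'I_n.-1) : 'I_n := Ordinal (hi_subproof r).

Definition swap_res (r : 'I_n.-1) (i : res_seq) : res_seq :=
  [ffun k => i (tperm (lo r) (hi r) k)].

Definition klr_gen : Type := (res_seq + 'I_n + 'I_n.-1)%type.
HB.instance Definition _ := Choice.on klr_gen.

Definition klr_free : Type := {malg F[{fmonom klr_gen}]}.
HB.instance Definition _ := GRing.Lalgebra.on klr_free.

Definition free_gen (g : klr_gen) : klr_free := mkmalgU (fmu g) 1.
Definition free_e (i : res_seq) : klr_free := free_gen (inl (inl i)).
Definition free_y (r : 'I_n) : klr_free := free_gen (inl (inr r)).
Definition free_psi (r : 'I_n.-1) : klr_free := free_gen (inr r).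

Local Notation ee := free_e.
Local Notation y := free_y.
Local Notation psi := free_psi.

Definition rarrow (a b : 'Z_e) : bool := b == a + 1.
Definition larrow (a b : 'Z_e) : bool := b == a - 1.

Definition psi_sq_coef (r : 'I_n.-1) (a b : 'Z_e) : klr_free :=
  if a == b then 0
  else if rarrow a b then y (hi r) - y (lo r)
  else if larrow a b then y (lo r) - y (hi r)
  else 1.

Definition braid_coef (a b c : 'Z_e) : klr_free :=
  if (c == a) && rarrow a b then 1
  else if (c == a) && larrow a b then -1
  else 0.

Implicit Type i j : res_seq.

Inductive klr_rel : klr_free -> klr_free -> Prop :=
| klr_ee i j : klr_rel (ee i * ee j) (if i == j then ee i else 0)
| klr_sum_e : klr_rel (\sum_(i : res_seq) ee i) 1
| klr_ye r i : klr_rel (y r * ee i) (ee i * y r)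
| klr_psie r i : klr_rel (psi r * ee i) (ee (swap_res r i) * psi r)
| klr_yy r s : klr_rel (y r * y s) (y s * y r)
| klr_psiy r s : s != lo r -> s != hi r -> klr_rel (psi r * y s) (y s * psi r)
| klr_psipsi (r s : 'I_n.-1) : (r.+1 < s)%N || (s.+1 < r)%N ->
    klr_rel (psi r * psi s) (psi s * psi r)
| klr_psiy_hi r i :
    klr_rel (psi r * y (hi r) * ee i)
            ((y (lo r) * psi r + (i (lo r) == i (hi r))%:R) * ee i)
| klr_ypsi_hi r i :
    klr_rel (y (hi r) * psi r * ee i)
            ((psi r * y (lo r) + (i (lo r) == i (hi r))%:R) * ee i)
| klr_psi_sq r i :
    klr_rel (psi r ^+ 2 * ee i) (psi_sq_coef r (i (lo r)) (i (hi r)) * ee i)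
| klr_braid (r s : 'I_n.-1) i : s = r.+1 :> nat ->
    klr_rel (psi r * psi s * psi r * ee i)
            ((psi s * psi r * psi s + braid_coef (i (lo r)) (i (hi r)) (i (hi s)))
             * ee i).

Definition klr_alg : Type := presented_alg klr_rel.
HB.instance Definition _ := GRing.PzRing.on klr_alg.

Definition klr_e (i : res_seq) : klr_alg := pi_alg klr_rel (free_e i).
Definition klr_y (r : 'I_n) : klr_alg := pi_alg klr_rel (free_y r).
Definition klr_psi (r : 'I_n.-1) : klr_alg := pi_alg klr_rel (free_psi r).

Variables (kappa1 kappa2 : 'Z_e).

Definition cyclo_exp (a : 'Z_e) : nat := ((kappa1 == a) + (kappa2 == a))%N.

(* Here r is the first position. *)
Inductive cyclo_rel : klr_alg -> klr_alg -> Prop :=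
| cyclo_y0 (r : 'I_n) i : r = 0%N :> nat ->
    cyclo_rel (klr_y r ^+ cyclo_exp (i r) * klr_e i) 0.

(* These quotients of the free F-algebra are recorded as rings; F acts on their
   modules through the image of F, which is central. *)
Definition cyclo_alg : Type := presented_alg cyclo_rel.
HB.instance Definition _ := GRing.PzRing.on cyclo_alg.

Definition cyclo_e (i : res_seq) : cyclo_alg := pi_alg cyclo_rel (klr_e i).
Definition cyclo_y (r : 'I_n) : cyclo_alg := pi_alg cyclo_rel (klr_y r).
Definition cyclo_psi (r : 'I_n.-1) : cyclo_alg := pi_alg cyclo_rel (klr_psi r).

Definition hook_res (m : nat) : res_seq :=
  [ffun k : 'I_n => if (k < m)%N then kappa2 - k%:R else kappa1 + (k - m)%N%:R].

(* The elements annihilating the generator of the Specht module labelled by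
   ((n - m), (1^m)); psi_m is psi r with r + 1 = m. *)
Inductive specht_rel (m : nat) : cyclo_alg -> Prop :=
| specht_e : specht_rel m (cyclo_e (hook_res m) - 1)
| specht_y r : specht_rel m (cyclo_y r)
| specht_psi (r : 'I_n.-1) : r.+1 != m -> specht_rel m (cyclo_psi r).

Definition specht (m : nat) : Type := cyclic_mod (specht_rel m).
HB.instance Definition _ m := GRing.Lmodule.on (specht m).
Definition specht_gen (m : nat) : specht m := cyclic_gen (specht_rel m).

(* v(a_1, ..., a_m), with a j = a_(j+1) - 1: the factor of index j is
   psi_(a j - 1) ... psi_j. *)
Definition specht_v (m : nat) (a : 'I_m -> nat) : specht m :=
  (\prod_(j < m) \prod_(r <- rev (enum 'I_n.-1) | (j <= r < a j)%N) cyclo_psi r)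
    *: specht_gen m.

(* v(1, ..., m, n) *)
Definition hook_v (m : nat) : specht m.+1 :=
  specht_v (fun j : 'I_m.+1 => if (j < m)%N then j : nat else n.-1).

(* A homomorphism is determined by the image of the generator; the zero map is a
   junk value, for the case where there is no such homomorphism. *)
Definition gamma (m : nat) : {linear specht m -> specht m.+1} :=
  if pselect (exists f : {linear specht m -> specht m.+1},
                f (specht_gen m) = hook_v m) is left ex
  then projT1 (cid ex) else \0.

End KLR.

(* Main.v *)
(** Words of length n in letters L (leg) and A (arm), with m letters L, index
    the standard basis of the Specht module of ((n - m), (1^m)).  Write
    d = n - r mod e.  On words the generators act by signed moves: psi_r turns
    LA at positions r, r + 1 into AL; it turns AL into LA if d is not 0, 1, -1;
    it turns A x L into ± L x A at positions r, r + 1, r + 2 if d = 1 and at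
    positions r - 1, r, r + 1 if d = -1; and if d = 0, then y_(r+1) and - y_r
    turn AL at r, r + 1 into LA.  The defining relations are local, hence can be
    checked on windows of six letters, and this gives a module on the span of
    all words.  Conversely, the relations express every element of the Specht
    module in the standard basis, by induction on the sum of the positions of
    the letters L, so that the Specht module is the span of the words with m
    letters L.

    Both letters have the same residue at position n, and changing a last letter
    A into L, words ending in L being sent to 0, commutes with all generators.
    This map is gamma: its kernel and its image are spanned by the words ending
    in L, whence exactness.  The words ending in L with a given number of
    letters L span a simple module: two such words are separated by some e(i) or
    by one of the idempotents y_(r+1) psi_r and psi_r y_(r+1), where d = 0, so a
    nonzero submodule contains a word, and this word can be sorted into
    L...LA...AL.  Sorting at d = -1 involves the letter at position r - 1, which
    exists because n is not 0 mod e, i.e. kappa2 <> kappa1 - 1. *)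

Require Import Defs.
From HB Require Import structures.
From mathcomp Require Import all_boot all_order all_algebra.
From mathcomp Require Import perm.
From mathcomp Require Import boolp zify ring.
From mathcomp.multinomials Require Import monalg.

Set Implicit Arguments.
Unset Strict Implicit.
Unset Printing Implicit Defensive.

Import GRing.Theory.
Local Open Scope ring_scope.

(** * Words and the local form of the relations *)

(* [true] is the letter L and [false] the letter A.  Positions are numbered from
   1; the letter at 0 is a dummy. *)
Definition word := nat -> bool.

Definition exch (a b : nat) (f : word) : word :=
  fun k => if k == a then f b else if k == b then f a else f k.

(* Position r is [Crit], [Pre] or [Post] if n - r is 0, 1 or -1 modulo e. *)
Inductive cls := Crit | Pre | Post | Reg.

(** Passing from r to r + 1 lowers d by 1. [Post] is followed by [Pre] exactly when -2 = 1, that is,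
    when e = 3. *)
Definition succ_cls (c c' : cls) : bool :=
  match c, c' with
  | Crit, Post | Post, Reg | Post, Pre | Reg, Reg | Reg, Pre | Pre, Crit => true
  | _, _ => false
  end.

(* [Some (s, f)] stands for the signed word (-1)^s f, and [None] for 0. *)
Definition wpsi (c : cls) (r : nat) (f : word) : option (bool * word) :=
  if f r && ~~ f r.+1 then Some (false, exch r r.+1 f) else
  match c with
  | Crit => None
  | Pre => if ~~ f r && f r.+2 then Some (~~ f r.+1, exch r r.+2 f) else None
  | Post => if ~~ f r.-1 && f r.+1 then Some (~~ f r, exch r.-1 r.+1 f) else None
  | Reg => if ~~ f r && f r.+1 then Some (false, exch r r.+1 f) else None
  end.

(** If r is [Post], then r - 1 is critical. So the two branches are y_s and y_(s+1) for a critical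
    position s, acting with opposite signs. *)
Definition wy (c : cls) (r : nat) (f : word) : option (bool * word) :=
  match c with
  | Crit => if ~~ f r && f r.+1 then Some (true, exch r r.+1 f) else None
  | Post => if ~~ f r.-1 && f r then Some (false, exch r.-1 r f) else None
  | _ => None
  end.

(** Operators compose from left to right: [wbind (T f) T'] stands for the product T' T applied to
    f. *)
Definition wbind (x : option (bool * word)) (T : word -> option (bool * word)) :=
  if x is Some (s, f) then
    if T f is Some (s', f') then Some (s (+) s', f') else None
  else None.

Definition wmap (G : word -> word) (x : option (bool * word)) :=
  if x is Some (s, f) then Some (s, G f) else None.

Definition wvec (V : zmodType) (d : word -> V) (x : option (bool * word)) : V :=
  if x is Some (s, f) then if s then - d f else d f else 0.

(* [sq_rhs] and [braid_rhs] are the coefficients of the quadratic and braid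
   relations, the residues being read off the letters; see [sq_rhsE] and
   [braid_rhsE]. *)
Definition sq_rhs (V : zmodType) (d : word -> V) (c c' : cls) r (f : word) : V :=
  let yd := wvec d (wy c' r.+1 f) - wvec d (wy c r f) in
  if f r == f r.+1 then if f r then - yd else yd
  else match c with
  | Crit => 0
  | Pre => if f r then - yd else yd
  | Post => if f r then yd else - yd
  | Reg => d f
  end.

Definition braid_rhs (V : zmodType) (d : word -> V) (c : cls) r (f : word) : V :=
  if f r == f r.+2 then 0 else
  match c with
  | Crit => if f r == f r.+1 then if f r then - d f else d f else 0
  | Pre => if f r.+1 == f r.+2 then if f r then - d f else d f else 0
  | _ => 0
  end.

Section Local.
Variables (V : zmodType) (d : word -> V).

(** In the local relations the operators sit at positions 1 to 3 and touch only the letters 0 to 5.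
    With these six letters concrete, each relation is a finite check. *)
Let wd (a0 a1 a2 a3 a4 a5 : bool) (g : word) : word := fun k =>
  match k with
  | 0 => a0 | 1 => a1 | 2 => a2 | 3 => a3 | 4 => a4 | 5 => a5 | k'.+4.+2 => g k'
  end%N.

Let wdE f : f = wd (f 0%N) (f 1%N) (f 2%N) (f 3%N) (f 4%N) (f 5%N)
                   (fun k => f k.+4.+2).
Proof. by apply: funext; do 6 ?[case=> //]. Qed.

Ltac letters f := rewrite (wdE f);
  move: (f 0%N) (f 1%N) (f 2%N) (f 3%N) (f 4%N) (f 5%N) (fun k => f k.+4.+2)
    => [] [] [] [] [] [] {}f.

(** The two sides may reach the same word through different exchanges; such words agree only letter
    by letter. *)
Ltac merge := match goal with
  | |- context [d ?x] => match goal with |- context [d ?y] =>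
      first [constr_eq x y; fail 1 |
             have -> : x = y by apply: funext; do 6 ?[case=> //]] end
  end.

Ltac local_check f := letters f;
  rewrite /= ?(oppr0, subr0, sub0r, addr0, add0r, opprK) //; do ?merge;
  rewrite ?(subrr, addNr, addrN) //.

Fact loc_psiy_hi c c' f : succ_cls c c' ->
  wvec d (wbind (wy c' 2 f) (wpsi c 1)) = wvec d (wbind (wpsi c 1 f) (wy c 1))
    + (if (if c is Crit then f 1%N != f 2%N else false) then d f else 0).
Proof. by case: c; case: c' => // _; local_check f. Qed.

Fact loc_ypsi_hi c c' f : succ_cls c c' ->
  wvec d (wbind (wpsi c 1 f) (wy c' 2)) = wvec d (wbind (wy c 1 f) (wpsi c 1))
    + (if (if c is Crit then f 1%N != f 2%N else false) then d f else 0).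
Proof. by case: c; case: c' => // _; local_check f. Qed.

Fact loc_psi_sq c c' f : succ_cls c c' ->
  wvec d (wbind (wpsi c 1 f) (wpsi c 1)) = sq_rhs d c c' 1 f.
Proof. by rewrite /sq_rhs; case: c; case: c' => // _; local_check f. Qed.

Fact loc_braid c c' f : succ_cls c c' ->
  wvec d (wbind (wbind (wpsi c 1 f) (wpsi c' 2)) (wpsi c 1)) =
  wvec d (wbind (wbind (wpsi c' 2 f) (wpsi c 1)) (wpsi c' 2))
    + braid_rhs d c 1 f.
Proof. by rewrite /braid_rhs; case: c; case: c' => // _; local_check f. Qed.

Fact loc_psipsi c c' c'' f : succ_cls c c' -> succ_cls c' c'' ->
  wvec d (wbind (wpsi c 1 f) (wpsi c'' 3)) =
  wvec d (wbind (wpsi c'' 3 f) (wpsi c 1)).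
Proof. by case: c; case: c' => //; case: c'' => // _ _; local_check f. Qed.

Fact loc_psiy c c' c'' f : succ_cls c c' -> succ_cls c' c'' ->
  wvec d (wbind (wpsi c 1 f) (wy c'' 3)) = wvec d (wbind (wy c'' 3 f) (wpsi c 1)).
Proof. by case: c; case: c' => //; case: c'' => // _ _; local_check f. Qed.

Fact loc_ypsi c c' c'' f : succ_cls c c' -> succ_cls c' c'' ->
  wvec d (wbind (wy c 1 f) (wpsi c'' 3)) = wvec d (wbind (wpsi c'' 3 f) (wy c 1)).
Proof. by case: c; case: c' => //; case: c'' => // _ _; local_check f. Qed.

Fact loc_ypsi1 c c' f : succ_cls c c' ->
  wvec d (wbind (wy c 1 f) (wpsi c' 2)) = wvec d (wbind (wpsi c' 2 f) (wy c 1)).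
Proof. by case: c; case: c' => // _; local_check f. Qed.

Fact loc_yy1 c c' f : succ_cls c c' ->
  wvec d (wbind (wy c 1 f) (wy c' 2)) = wvec d (wbind (wy c' 2 f) (wy c 1)).
Proof. by case: c; case: c' => // _; local_check f. Qed.

Fact loc_yy2 c c' c'' f : succ_cls c c' -> succ_cls c' c'' ->
  wvec d (wbind (wy c 1 f) (wy c'' 3)) = wvec d (wbind (wy c'' 3 f) (wy c 1)).
Proof. by case: c; case: c' => //; case: c'' => // _ _; local_check f. Qed.

End Local.

(** * Cutting words and moving the local relations to arbitrary positions *)

Definition glue (b : nat) (f g : word) : word :=
  fun k => if (k < b)%N then f k else g (k - b)%N.

Lemma glueE b f : f = glue b f (fun k => f (b + k)%N).
Proof.
by apply: funext => k; rewrite /glue; case: ltnP => // ?; rewrite subnKC.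
Qed.

Lemma glue_lo b f g k : (k < b)%N -> glue b f g k = f k.
Proof. by rewrite /glue => ->. Qed.

Lemma glue_hi b f g k : glue b f g (b + k)%N = g k.
Proof. by rewrite /glue ltnNge leq_addr addKn. Qed.

Lemma exch_lo b f g i j : (i < b)%N -> (j < b)%N ->
  exch i j (glue b f g) = glue b (exch i j f) g.
Proof.
move=> ib jb; apply: funext => k; rewrite /exch /glue ib jb.
case: ifP => [/eqP->|]; first by rewrite ib.
by case: ifP => [/eqP->|//]; rewrite jb.
Qed.

Lemma exch_hi b f g i j :
  exch (b + i) (b + j) (glue b f g) = glue b f (exch i j g).
Proof.
apply: funext => k; rewrite /exch !glue_hi /glue.
case: (ltnP k b) => kb; first by rewrite !ltn_eqF // ltn_addr.
by rewrite -{1 2}(subnKC kb) !eqn_add2l.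
Qed.

Lemma wvec_map (V : zmodType) (d : word -> V) G x :
  wvec d (wmap G x) = wvec (d \o G) x.
Proof. by case: x => [[]|]. Qed.

Lemma wbind_map G x T T' : (forall f, T (G f) = wmap G (T' f)) ->
  wbind (wmap G x) T = wmap G (wbind x T').
Proof. by case: x => [[s f]|] //= ->; case: (T' f) => [[]|]. Qed.

Section Shift.
Variables (b : nat) (h : word).

Lemma wpsi_hi c s f : wpsi c (b + s.+1) (glue b h f) = wmap (glue b h) (wpsi c s.+1 f).
Proof.
rewrite /wpsi -!addnS addnS /= !glue_hi -!addnS !glue_hi !exch_hi.
by case: c; do 2 ?[case: ifP => //].
Qed.

(** At the first position right of the cut, [Post] is the only class that reads a letter left of
    it. *)
Lemma wpsi_hi0 c f : c <> Post ->
  wpsi c b (glue b h f) = wmap (glue b h) (wpsi c 0 f).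
Proof.
rewrite /wpsi -{1 3 5 9 11 15}[b]addn0 => cP.
have e0 := glue_hi b h f 0; have e1 := glue_hi b h f 1.
have e2 := glue_hi b h f 2; rewrite addn0 addn1 addn2 in e0 e1 e2.
have x1 := exch_hi b h f 0 1; have x2 := exch_hi b h f 0 2.
rewrite addn0 addn1 addn2 in x1 x2; rewrite ?addn0 e0 e1 x1 ?e2 ?x2.
by case: c cP => // _; do 2 ?[case: ifP => //].
Qed.

Lemma wy_hi c s f : wy c (b + s.+1) (glue b h f) = wmap (glue b h) (wy c s.+1 f).
Proof.
rewrite /wy -!addnS addnS /= !glue_hi -!addnS !glue_hi !exch_hi.
by case: c; do 2 ?[case: ifP => //].
Qed.

Lemma wy_hi0 c f : c <> Post ->
  wy c b (glue b h f) = wmap (glue b h) (wy c 0 f).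
Proof.
have e0 := glue_hi b h f 0; have e1 := glue_hi b h f 1.
rewrite addn0 addn1 in e0 e1.
have x1 := exch_hi b h f 0 1; rewrite addn0 addn1 in x1.
by rewrite /wy => cP; case: c cP => // _; rewrite e0 e1 x1; case: ifP.
Qed.

Lemma wpsi_lo c r f : (r.+1 < b)%N -> (c = Pre -> (r.+2 < b)%N) ->
  wpsi c r (glue b f h) = wmap (glue b ^~ h) (wpsi c r f).
Proof.
move=> rb cP; have rb' := ltnW rb.
have rp : (r.-1 < b)%N := leq_ltn_trans (leq_pred r) rb'.
rewrite /wpsi; case: c cP => cP.
4: by rewrite !(glue_lo f h rb, glue_lo f h rb') exch_lo //; do 2 ?case: ifP.
3: by rewrite !(glue_lo f h rb, glue_lo f h rb', glue_lo f h rp) !exch_lo //;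
      do 2 ?case: ifP.
2: have rb2 := cP erefl.
2: by rewrite !(glue_lo f h rb, glue_lo f h rb', glue_lo f h rb2) !exch_lo //;
      do 2 ?case: ifP.
by rewrite !(glue_lo f h rb, glue_lo f h rb') exch_lo //; case: ifP.
Qed.

Lemma wy_lo c r f : (r < b)%N -> (c = Crit -> (r.+1 < b)%N) ->
  wy c r (glue b f h) = wmap (glue b ^~ h) (wy c r f).
Proof.
move=> rb cP.
have rp : (r.-1 < b)%N := leq_ltn_trans (leq_pred r) rb.
rewrite /wy; case: c cP => cP //.
  have rb2 := cP erefl.
  by rewrite (glue_lo f h rb) (glue_lo f h rb2) exch_lo //; case: ifP.
by rewrite (glue_lo f h rb) (glue_lo f h rp) exch_lo //; case: ifP.
Qed.

End Shift.

(** Each operator changes its own side of the cut, and the signs add up in either order. *)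
Lemma wbind_disjoint b f (T T' : word -> option (bool * word)) T1 T2 :
    (forall h f, T (glue b f h) = wmap (glue b ^~ h) (T1 f)) ->
    (forall h f, T' (glue b h f) = wmap (glue b h) (T2 f)) ->
  wbind (T f) T' = wbind (T' f) T.
Proof.
move=> HT HT'; rewrite (glueE b f) HT HT'.
case E1: (T1 f) => [[s1 f1]|]; case E2: (T2 _) => [[s2 f2]|] //=.
- by rewrite HT HT' E1 E2 /= addbC.
- by rewrite HT' E2.
- by rewrite HT E1.
Qed.

Section Relations.
Variable (c : nat -> cls).
Hypothesis hc : forall k, succ_cls (c k) (c k.+1).
Variables (V : zmodType) (d : word -> V).

Let psi r := wpsi (c r) r.
Let y r := wy (c r) r.

(** After [Pre] come [Crit], [Post] and then [Reg] or [Pre]. Hence a three-letter move on k, k + 1,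
    k + 2 never meets one on k + 2, k + 3, k + 4. *)
Lemma cls_not_post k : c k = Pre -> c k.+3 <> Post.
Proof.
move=> e E; have := hc k; have := hc k.+1; have := hc k.+2; rewrite e E.
by case: (c k.+1); case: (c k.+2).
Qed.

Let psiE r s h g : psi (r + s.+1) (glue r h g) = wmap (glue r h) (wpsi (c (r + s.+1)) s.+1 g).
Proof. exact: wpsi_hi. Qed.
Let yE r s h g : y (r + s.+1) (glue r h g) = wmap (glue r h) (wy (c (r + s.+1)) s.+1 g).
Proof. exact: wy_hi. Qed.

Lemma wpsi_y_hi r f : (0 < r)%N ->
  wvec d (wbind (y r.+1 f) (psi r)) = wvec d (wbind (psi r f) (y r))
    + (if (if c r is Crit then f r != f r.+1 else false) then d f else 0).
Proof.
(* The cut lies just before the letter that precedes the given position, which thus becomes position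
   1 of the window. *)
case: r => // r _; rewrite (glueE r f); move: (fun k => f (r + k)%N) => g.
rewrite -[r.+1]addn1 -addnS yE psiE.
rewrite (wbind_map _ (psiE r 0 f)) (wbind_map _ (yE r 0 f)) !wvec_map !glue_hi.
by apply: loc_psiy_hi; rewrite !addnS.
Qed.

Lemma wy_hi_psi r f : (0 < r)%N ->
  wvec d (wbind (psi r f) (y r.+1)) = wvec d (wbind (y r f) (psi r))
    + (if (if c r is Crit then f r != f r.+1 else false) then d f else 0).
Proof.
case: r => // r _; rewrite (glueE r f); move: (fun k => f (r + k)%N) => g.
rewrite -[r.+1]addn1 -addnS yE psiE.
rewrite (wbind_map _ (psiE r 0 f)) (wbind_map _ (yE r 1 f)) !wvec_map !glue_hi.
by apply: loc_ypsi_hi; rewrite !addnS.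
Qed.

Lemma wpsi_sq r f : (0 < r)%N ->
  wvec d (wbind (psi r f) (psi r)) = sq_rhs d (c r) (c r.+1) r f.
Proof.
case: r => // r _; rewrite (glueE r f); move: (fun k => f (r + k)%N) => g.
rewrite -[r.+1]addn1 psiE (wbind_map _ (psiE r 0 f)) wvec_map.
rewrite (@loc_psi_sq _ _ _ (c (r + 1).+1)).
  by rewrite /sq_rhs -!addnS !glue_hi !wy_hi !wvec_map.
exact: hc.
Qed.

Lemma wbraid r f : (0 < r)%N ->
  wvec d (wbind (wbind (psi r f) (psi r.+1)) (psi r)) =
  wvec d (wbind (wbind (psi r.+1 f) (psi r)) (psi r.+1)) + braid_rhs d (c r) r f.
Proof.
case: r => // r _; rewrite (glueE r f); move: (fun k => f (r + k)%N) => g.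
rewrite -[r.+1]addn1 -addnS !psiE.
rewrite !(wbind_map _ (psiE r 0 f), wbind_map _ (psiE r 1 f)) !wvec_map.
rewrite loc_braid; last by rewrite !addnS.
by rewrite /braid_rhs -!addnS !glue_hi.
Qed.

Let psi_hi b s : (b <= s)%N -> (s = b -> c s <> Post) ->
  exists T, forall h f, psi s (glue b h f) = wmap (glue b h) (T f).
Proof.
rewrite leq_eqVlt => /orP[/eqP-> /(_ erefl) cP|bs _].
  by eexists => h f; rewrite /psi wpsi_hi0.
eexists => h f; rewrite /psi -{2}(subnKC bs) addSnnS wpsi_hi; reflexivity.
Qed.

Let y_hi b s : (b <= s)%N -> (s = b -> c s <> Post) ->
  exists T, forall h f, y s (glue b h f) = wmap (glue b h) (T f).
Proof.
rewrite leq_eqVlt => /orP[/eqP-> /(_ erefl) cP|bs _].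
  by eexists => h f; rewrite /y wy_hi0.
eexists => h f; rewrite /y -{2}(subnKC bs) addSnnS wy_hi; reflexivity.
Qed.

(* A cut between the letters touched by psi r and those touched by the operators
   at positions greater than r + 2. *)
Let psi_lo r : exists2 b, (b <= r.+3)%N /\ (b = r.+3 -> c b <> Post) &
  exists T, forall h f, psi r (glue b f h) = wmap (glue b ^~ h) (T f).
Proof.
have [E|E] : c r = Pre \/ c r <> Pre by case: (c r); [right|left|right|right].
  exists r.+3; first by split=> // _; apply: cls_not_post.
  by exists (wpsi (c r) r) => h f; apply: wpsi_lo.
exists r.+2; first by split=> // /eqP; rewrite ltn_eqF.
by exists (wpsi (c r) r) => h f; apply: wpsi_lo.
Qed.

Let y_lo r : exists T, forall h f, y r (glue r.+2 f h) = wmap (glue r.+2 ^~ h) (T f).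
Proof. by exists (wy (c r) r) => h f; apply: wy_lo. Qed.

Let psi_far r s T f : (r.+2 < s)%N ->
    (forall b, (b <= s)%N -> (s = b -> c s <> Post) ->
       exists T', forall h g, T (glue b h g) = wmap (glue b h) (T' g)) ->
  wbind (psi r f) T = wbind (T f) (psi r).
Proof.
move=> rs HT; have [b [br bP] [T1 H1]] := psi_lo r.
have bs := leq_trans br rs.
have [|T2 H2] := HT b bs; last exact: (wbind_disjoint _ H1 H2).
by move=> sb; rewrite sb; apply: bP; apply/eqP; rewrite eqn_leq br -sb.
Qed.

(** At distance two the moves can overlap, and the window is checked; at larger distances some cut
    separates them. *)
Lemma wpsi_psi r s f : (0 < r)%N -> (r.+1 < s)%N ->
  wvec d (wbind (psi r f) (psi s)) = wvec d (wbind (psi s f) (psi r)).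
Proof.
move=> r0; rewrite leq_eqVlt => /orP[/eqP<-|rs].
  case: r r0 => // r _; rewrite (glueE r f); move: (fun k => f (r + k)%N) => g.
  rewrite -[r.+1]addn1 -2!addnS !psiE (wbind_map _ (psiE r 0 f)).
  rewrite (wbind_map _ (psiE r 2 f)) !wvec_map.
  by apply: (@loc_psipsi _ _ _ (c r.+2)); rewrite !addnS addn0.
by congr wvec; apply: (@psi_far _ s) => // b; apply: psi_hi.
Qed.

Lemma wpsi_y r s f : (0 < r)%N -> (0 < s)%N -> s <> r -> s <> r.+1 ->
  wvec d (wbind (psi r f) (y s)) = wvec d (wbind (y s f) (psi r)).
Proof.
move=> r0 s0 sr sr1; have [rs|] := ltnP r.+1 s.
  move: rs; rewrite leq_eqVlt => /orP[/eqP<-|rs].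
    case: r r0 {sr sr1} => // r _; rewrite (glueE r f).
    move: (fun k => f (r + k)%N) => g.
    rewrite -[r.+1]addn1 -2!addnS psiE yE (wbind_map _ (psiE r 0 f)).
    rewrite (wbind_map _ (yE r 2 f)) !wvec_map.
    by apply: (@loc_psiy _ _ _ (c r.+2)); rewrite !addnS addn0.
  by congr wvec; apply: (@psi_far _ s) => // b; apply: y_hi.
rewrite leq_eqVlt => /orP[/eqP//|]; rewrite ltnS leq_eqVlt => /orP[/eqP//|].
rewrite leq_eqVlt => /orP[/eqP rs|].
  rewrite -rs; case: s s0 {sr sr1 rs} => // s _; rewrite (glueE s f).
  move: (fun k => f (s + k)%N) => g.
  rewrite -[s.+1]addn1 -addnS psiE yE (wbind_map _ (psiE s 1 f)).
  rewrite (wbind_map _ (yE s 0 f)) !wvec_map; apply/esym.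
  by apply: loc_ypsi1; rewrite !addnS.
rewrite leq_eqVlt => /orP[/eqP rs|].
  rewrite -rs; case: s s0 {sr sr1 rs} => // s _; rewrite (glueE s f).
  move: (fun k => f (s + k)%N) => g.
  rewrite -[s.+1]addn1 -2!addnS psiE yE (wbind_map _ (psiE s 2 f)).
  rewrite (wbind_map _ (yE s 0 f)) !wvec_map; apply/esym.
  by apply: (@loc_ypsi _ _ _ (c s.+2)); rewrite !addnS addn0.
move=> rs; congr wvec; have [T1 H1] := y_lo s.
have [||T2 H2] := @psi_hi s.+2 r; first exact: ltnW.
  by move=> E; rewrite E ltnn in rs.
by apply/esym; apply: (wbind_disjoint _ H1 H2).
Qed.

Lemma wy_y r s f : (0 < r)%N -> (0 < s)%N ->
  wvec d (wbind (y r f) (y s)) = wvec d (wbind (y s f) (y r)).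
Proof.
wlog rs : r s / (r < s)%N.
  move=> H r0 s0; have [rs|sr|->] // := ltngtP r s; first exact: H.
  by apply/esym; apply: H.
move=> r0 _; move: rs; rewrite leq_eqVlt => /orP[/eqP<-|].
  case: r r0 => // r _; rewrite (glueE r f).
  move: (fun k => f (r + k)%N) => g.
  rewrite -[r.+1]addn1 -addnS !yE (wbind_map _ (yE r 0 f)).
  by rewrite (wbind_map _ (yE r 1 f)) !wvec_map; apply: loc_yy1; rewrite !addnS.
rewrite leq_eqVlt => /orP[/eqP<-|rs].
  case: r r0 => // r _; rewrite (glueE r f).
  move: (fun k => f (r + k)%N) => g.
  rewrite -[r.+1]addn1 -2!addnS !yE (wbind_map _ (yE r 0 f)).
  rewrite (wbind_map _ (yE r 2 f)) !wvec_map.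
  by apply: (@loc_yy2 _ _ _ (c r.+2)); rewrite !addnS addn0.
congr wvec; have [T1 H1] := y_lo r.
have [||T2 H2] := @y_hi r.+2 s; first exact: ltnW.
  by move=> E; rewrite E ltnn in rs.
exact: (wbind_disjoint _ H1 H2).
Qed.

End Relations.

Lemma Zp_nat_eq0 (e k : nat) : (1 < e)%N -> ((k%:R : 'Z_e) == 0) = (e %| k)%N.
Proof.
by move=> e1; rewrite -val_eqE /= val_Zp_nat.
Qed.

(** * Residues *)

Section Residues.
Variables (e n : nat) (kappa2 : 'Z_e).
Hypothesis he : (3 <= e)%N.

(* The residue of a leg minus that of an arm, read at position k. *)
Definition gap (k : nat) : 'Z_e := n%:R - k%:R.

Definition gap_cls (k : nat) : cls :=
  if gap k == 0 then Crit else if gap k == 1 then Pre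
  else if gap k == -1 then Post else Reg.

Lemma one_neq0 : (1 : 'Z_e) != 0.
Proof. exact: oner_neq0. Qed.

Lemma two_neq0 : (1 + 1 : 'Z_e) != 0.
Proof. by rewrite -[1 + 1]/(2%:R) Zp_nat_eq0 ?(ltnW he) // gtnNdvd. Qed.

Lemma gapS k : gap k.+1 = gap k - 1.
Proof. by rewrite /gap -natr1; ring. Qed.

Variant gap_cls_spec k : cls -> Type :=
| GapCrit of gap k = 0 : gap_cls_spec k Crit
| GapPre of gap k = 1 : gap_cls_spec k Pre
| GapPost of gap k = -1 : gap_cls_spec k Post
| GapReg of gap k != 0 & gap k != 1 & gap k != -1 : gap_cls_spec k Reg.

Lemma gap_clsP k : gap_cls_spec k (gap_cls k).
Proof.
rewrite /gap_cls; case: eqP => [?|/eqP ?]; first exact: GapCrit.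
case: eqP => [?|/eqP ?]; first exact: GapPre.
by case: eqP => [?|/eqP ?]; [exact: GapPost|exact: GapReg].
Qed.

Lemma one_neqN1 : (1 : 'Z_e) != -1.
Proof. by rewrite -addr_eq0 two_neq0. Qed.

Lemma gap_cls_succ k : succ_cls (gap_cls k) (gap_cls k.+1).
Proof.
have h1 := one_neq0; have h2 := two_neq0; have h3 := negPf one_neqN1.
rewrite {2}/gap_cls gapS.
case: (gap_clsP k) => [->|->|->|/negPf g0 g1 gN1].
- by rewrite sub0r oppr_eq0 (negPf h1) [-1 == 1]eq_sym h3 eqxx.
- by rewrite subrr eqxx.
- rewrite -[-1 - 1 == -1]subr_eq0 opprK subrK -opprD !oppr_eq0.
  by rewrite (negPf h2) (negPf h1); case: ifP.
- rewrite subr_eq0 (negPf g1) -[_ == -1]subr_eq0 opprK subrK g0.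
  by case: ifP.
Qed.

Definition leg_count (f : word) (k : nat) : nat := \sum_(i < k) f i.

Lemma leg_countS f k : leg_count f k.+1 = (leg_count f k + f k)%N.
Proof. by rewrite /leg_count big_ord_recr. Qed.

(** As n = kappa2 - kappa1 + 1, the value at an arm is kappa1 + (k - 1 - [leg_count f k]), that is,
    kappa1 plus the number of arms at the positions 1, ..., k - 1 (the letter at 0 being A). *)
Definition wres (f : word) (k : nat) : 'Z_e :=
  kappa2 - (leg_count f k)%:R - (if f k then 0 else gap k).

(** Corrections are added on both sides to avoid truncated subtraction. *)
Lemma leg_count_exch f a b k : (a < b)%N ->
  (leg_count (exch a b f) k + (a < k <= b)%N * f a =
   leg_count f k + (a < k <= b)%N * f b)%N.
Proof.
move=> ab; elim: k => [|k]; first by rewrite /leg_count !big_ord0.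
rewrite !leg_countS /exch; have [->|ka] := eqVneq k a.
  by case: (f a); case: (f b); lia.
by have [->|kb] := eqVneq k b; case: (f a); case: (f b); lia.
Qed.

Lemma wresS f r : (wres f r.+1 = wres f r +
  if f r then if f r.+1 then -1 else - gap r else if f r.+1 then gap r else 1).
Proof.
rewrite /wres leg_countS natrD gapS.
by case: (f r); case: (f r.+1); rewrite /=; ring.
Qed.

Definition nat_swap (r k : nat) : nat :=
  if k == r then r.+1 else if k == r.+1 then r else k.

Lemma wres_exch f a b k : (a < b)%N -> f a != f b ->
  let s : 'Z_e := if f b then 1 else -1 in
  wres (exch a b f) k = wres f k +
    (if k == a then s * gap a else if k == b then - s - s * gap b
     else if (a < k < b)%N then - s else 0).
Proof.
move=> ab fab /=; have := leg_count_exch f k ab; rewrite /wres.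
rewrite [exch a b f k]/exch; have [->|ka] := eqVneq k a.
  rewrite ltnn /= !addn0 => ->; case: (f a) (f b) fab => [] [] //= _; ring.
have [->|kb] := eqVneq k b.
  rewrite ab leqnn !mul1n => L.
  have {L} : (leg_count (exch a b f) b)%:R + (f a)%:R =
             (leg_count f b)%:R + (f b)%:R :> 'Z_e by rewrite -!natrD L.
  move/(canRL (addrK _)) ->.
  by case: (f a) (f b) fab => [] [] //= _; ring.
have -> : (a < k <= b)%N = (a < k < b)%N by lia.
case: (a < k < b)%N; last by rewrite !mul0n !addn0 addr0 => ->.
rewrite !mul1n => L.
have {L} : (leg_count (exch a b f) k)%:R + (f a)%:R =
           (leg_count f k)%:R + (f b)%:R :> 'Z_e by rewrite -!natrD L.
move/(canRL (addrK _)) ->.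
by case: (f a) (f b) fab => [] [] //= _; ring.
Qed.

(** Even a three-letter move permutes the residues by s_r alone: the residue at its extra position,
    r + 2 for [Pre] and r - 1 for [Post], does not change. *)
Lemma wres_psi r f s f' k : (0 < r)%N -> wpsi (gap_cls r) r f = Some (s, f') ->
  wres f' k = wres f (nat_swap r k).
Proof.
have swapr : f r != f r.+1 -> wres (exch r r.+1 f) k = wres f (nat_swap r k).
  move=> ne; rewrite wres_exch // /nat_swap; have [->|kr] := eqVneq k r.
    by rewrite wresS; case: (f r) (f r.+1) ne => [] [] //= _; ring.
  have [->|kr1] := eqVneq k r.+1.
    by rewrite wresS gapS; case: (f r) (f r.+1) ne => [] [] //= _; ring.
  have -> : (r < k < r.+1)%N = false by lia.
  by rewrite addr0.
move=> r0; rewrite /wpsi; case: ifP => [/andP[fr fr1] [_ <-]|_].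
  by apply: swapr; rewrite fr (negPf fr1).
case: gap_clsP => [g|g|g|g0 g1 gN1] //.
- case: ifP => // /andP[/negPf fr fr2] [_ <-]; rewrite wres_exch ?fr ?fr2 //.
  rewrite /nat_swap; have [->|kr] := eqVneq k r.
    by rewrite wresS fr g; case: (f r.+1); ring.
  have [->|kr1] := eqVneq k r.+1.
    by rewrite ltn_eqF // !ltnSn /= wresS fr g; case: (f r.+1); ring.
  have [->|kr2] := eqVneq k r.+2; first by rewrite !gapS g; ring.
  have -> : (r < k < r.+2)%N = false by lia.
  by rewrite addr0.
(* From here on [r] is the critical position just before the [Post] position. *)
- case: r r0 swapr g => // r _ _ g /=.
  have {}g : gap r = 0 by apply: (addIr (-1)); rewrite -gapS g add0r.
  case: ifP => // /andP[/negPf fr fr2] [_ <-]; rewrite wres_exch ?fr ?fr2 //.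
  rewrite /nat_swap; have [->|kr] := eqVneq k r.
    have -> : (r == r.+1) = false by lia.
    have -> : (r == r.+2) = false by lia.
    by rewrite g; ring.
  have [->|kr1] := eqVneq k r.+1.
    by rewrite ltn_eqF // !ltnSn /= !wresS fr fr2 gapS g; case: (f r.+1); ring.
  have [->|kr2] := eqVneq k r.+2.
    by rewrite !wresS fr fr2 !gapS g; case: (f r.+1); ring.
  have -> : (r < k < r.+2)%N = false by lia.
  by rewrite addr0.
- case: ifP => // /andP[fr fr1] [_ <-].
  by apply: swapr; rewrite (negPf fr) fr1.
Qed.

(** The letters exchanged are at a critical position a and at a + 1. The gap 0 makes the residue at
    a independent of the letter, and the gap -1 at a + 1 offsets the change of the leg count. *)
Lemma wres_y r f s f' k : (0 < r)%N -> wy (gap_cls r) r f = Some (s, f') ->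
  wres f' k = wres f k.
Proof.
have crit a : gap a = 0 -> f a != f a.+1 -> wres (exch a a.+1 f) k = wres f k.
  move=> g ne; rewrite wres_exch // gapS g.
  have [->|ka] := eqVneq k a; first by ring.
  have [->|ka1] := eqVneq k a.+1; first by ring.
  have -> : (a < k < a.+1)%N = false by lia.
  by rewrite addr0.
move=> r0; rewrite /wy; case: gap_clsP => [g|g|g|g0 g1 gN1] //.
  case: ifP => // /andP[/negPf fr fr1] [_ <-].
  by apply: crit; rewrite ?fr ?fr1.
case: r r0 g => // r _ g; case: ifP => // /andP[/negPf fr fr1] [_ <-] /=.
apply: crit; last by rewrite fr fr1.
by apply: (addIr (-1)); rewrite -gapS g add0r.
Qed.

Lemma wres_eq r f :
  (wres f r == wres f r.+1) = (if gap_cls r is Crit then f r != f r.+1 else false).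
Proof.
have h1 := negPf one_neq0; rewrite wresS -subr_eq0 opprD addNKr oppr_eq0.
case: gap_clsP => [g|g|g|/negPf g0 _ _]; case: (f r) (f r.+1) => [] [];
  by rewrite ?g ?g0 ?(oppr0, oppr_eq0, eqxx, h1).
Qed.

Lemma rarrow_wres r f : rarrow (wres f r) (wres f r.+1) =
  if f r == f r.+1 then ~~ f r
  else match gap_cls r with Pre => ~~ f r | Post => f r | _ => false end.
Proof.
have h1 := negPf one_neq0; have h2 := negPf two_neq0.
have h3 := negPf one_neqN1.
rewrite /rarrow wresS (inj_eq (addrI _)).
case: gap_clsP => [g|g|g|/negPf g0 /negPf g1 /negPf gN1];
  case: (f r) (f r.+1) => [] []; rewrite /= ?g ?oppr0 ?opprK
    ?[0 == 1]eq_sym ?[-1 == 1]eq_sym ?h1 ?h3 ?eqxx // ?g1 //.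
by rewrite eqr_oppLR gN1.
Qed.

Lemma larrow_wres r f : larrow (wres f r) (wres f r.+1) =
  if f r == f r.+1 then f r
  else match gap_cls r with Pre => f r | Post => ~~ f r | _ => false end.
Proof.
have h1 := negPf one_neq0; have h3 := negPf one_neqN1.
rewrite /larrow wresS (inj_eq (addrI _)).
case: gap_clsP => [g|g|g|/negPf g0 /negPf g1 /negPf gN1];
  case: (f r) (f r.+1) => [] []; rewrite /= ?g ?oppr0 ?opprK
    ?[0 == -1]eq_sym ?oppr_eq0 ?h1 ?h3 ?eqxx // ?gN1 //.
by rewrite eqr_opp g1.
Qed.

Lemma wres_eq2 r f : (wres f r.+2 == wres f r) =
  if f r == f r.+2 then false
  else match gap_cls r with
       | Crit => f r == f r.+1 | Pre => f r != f r.+1 | _ => false end.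
Proof.
have h1 := negPf one_neq0; have h2 := negPf two_neq0.
rewrite !wresS gapS -addrA -[X in _ == X]addr0 (inj_eq (addrI _)).
case: gap_clsP => [g|g|g|/negPf g0 /negPf g1 /negPf gN1];
  case: (f r) (f r.+1) (f r.+2) => [] [] []; rewrite /= ?g.
(* In every case the difference of the two residues is one of these nine expressions, and neither 1
   nor 1 + 1 vanishes since e is at least 3. *)
all: match goal with |- (?E == 0) = _ =>
  first [have -> : E = 0 by ring | have -> : E = 1 by ring
       | have -> : E = -1 by ring | have -> : E = 1 + 1 by ring
       | have -> : E = - (1 + 1) by ring | have -> : E = gap r by ring
       | have -> : E = - gap r by ring | have -> : E = gap r - 1 by ring
       | have -> : E = - (gap r - 1) by ring ]
  end; by rewrite ?oppr_eq0 ?(eqxx, h1, h2, g0) ?subr_eq0 ?g1.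
Qed.

Lemma sq_rhsE (V : zmodType) (d : word -> V) r f :
  let yhi := wvec d (wy (gap_cls r.+1) r.+1 f) in
  let ylo := wvec d (wy (gap_cls r) r f) in
  sq_rhs d (gap_cls r) (gap_cls r.+1) r f =
    if wres f r == wres f r.+1 then 0
    else if rarrow (wres f r) (wres f r.+1) then yhi - ylo
    else if larrow (wres f r) (wres f r.+1) then ylo - yhi else d f.
Proof.
rewrite /sq_rhs wres_eq rarrow_wres larrow_wres -[_ - wvec d (wy (gap_cls r.+1) _ _)]opprB.
by case: (gap_cls r); case: (f r); case: (f r.+1).
Qed.

Lemma braid_rhsE (V : zmodType) (d : word -> V) r f :
  braid_rhs d (gap_cls r) r f =
    if (wres f r.+2 == wres f r) && rarrow (wres f r) (wres f r.+1) then d f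
    else if (wres f r.+2 == wres f r) && larrow (wres f r) (wres f r.+1)
    then - d f else 0.
Proof.
rewrite /braid_rhs wres_eq2 rarrow_wres larrow_wres.
by case: (gap_cls r); case: (f r); case: (f r.+1); case: (f r.+2).
Qed.

End Residues.

(** * The representation on words *)

Section Encoding.
Variables (F : fieldType) (n : nat).

Definition fword : Type := {ffun 'I_n -> bool}.
HB.instance Definition _ := Finite.on fword.

Definition ext (w : fword) : word := fun k =>
  if k is k'.+1 then if insub k' is Some i then w i else false else false.

Definition restr (f : word) : fword := [ffun i : 'I_n => f i.+1].

Lemma extE (w : fword) (i : 'I_n) : ext w i.+1 = w i.
Proof. by rewrite /ext valK. Qed.

Lemma ext_out w k : (n < k)%N -> ext w k = false.
Proof. by case: k => // k nk; rewrite /ext insubN // -leqNgt. Qed.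

Lemma extK : cancel ext restr.
Proof. by move=> w; apply/ffunP => i; rewrite ffunE extE. Qed.

Definition supported (f : word) := ~~ f 0%N /\ forall k, (n < k)%N -> ~~ f k.

Lemma ext_supported w : supported (ext w).
Proof. by split=> // k nk; rewrite ext_out. Qed.

Lemma restrK f : supported f -> ext (restr f) = f.
Proof.
move=> [f0 fn]; apply: funext => -[|k]; first by rewrite (negPf f0).
have [kn|nk] := ltnP k n; first by rewrite (extE _ (Ordinal kn)) ffunE.
by rewrite ext_out // (negPf (fn _ _)).
Qed.

(** With a successor as dimension, the square matrices form a nontrivial ring. *)
Lemma card_fword : #|{: fword}| = #|{: fword}|.-1.+1.
Proof. by rewrite prednK // -cardsT; apply/card_gt0P; exists [ffun=> false]; rewrite inE. Qed.

Local Notation dim := (#|{: fword}|.-1).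
Definition code (w : fword) : 'I_dim.+1 := cast_ord card_fword (enum_rank w).
Definition decode (i : 'I_dim.+1) : fword := enum_val (cast_ord (esym card_fword) i).

Lemma codeK : cancel code decode.
Proof. by move=> w; rewrite /decode /code cast_ordK enum_rankK. Qed.
Lemma decodeK : cancel decode code.
Proof. by move=> i; rewrite /decode /code enum_valK cast_ordKV. Qed.

Definition basis (w : fword) : 'cV[F]_dim.+1 := delta_mx (code w) 0.

Definition opmx (g : fword -> 'cV[F]_dim.+1) : 'M[F]_dim.+1 :=
  \matrix_(i, j) g (decode j) i 0.

Lemma opmxE g w : opmx g *m basis w = g w.
Proof.
by rewrite -colE; apply/colP => i; rewrite !mxE codeK.
Qed.

Lemma mx_eqP (A B : 'M[F]_dim.+1) :
  (forall w, A *m basis w = B *m basis w) -> A = B.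
Proof.
move=> H; apply/matrixP => i j; have := congr1 (fun v : 'cV_ _ => v i 0) (H (decode j)).
by rewrite /basis decodeK -!colE !mxE.
Qed.

Definition bvec (f : word) : 'cV[F]_dim.+1 := basis (restr f).

Definition supp_res (x : option (bool * word)) :=
  if x is Some (_, f) then supported f else True.

Definition wop (T : word -> option (bool * word)) : 'M[F]_dim.+1 :=
  opmx (fun w => wvec bvec (T (ext w))).

Lemma wop_bvec T f : supported f -> wop T *m bvec f = wvec bvec (T f).
Proof. by move=> sf; rewrite /bvec opmxE restrK. Qed.

Lemma wop_wvec T x : supp_res x -> wop T *m wvec bvec x = wvec bvec (wbind x T).
Proof.
case: x => [[s f]|] /= sf; last by rewrite mulmx0.
case: s; rewrite ?mulmxN wop_bvec //; case: (T f) => [[[] g]|] //=.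
  by rewrite opprK.
by rewrite oppr0.
Qed.

Lemma supported_le f k : supported f -> f k -> (k <= n)%N.
Proof. by move=> [_ fn]; apply: contraTT; rewrite -ltnNge => /fn. Qed.

Lemma exch_supported f a b : (0 < a <= n)%N -> (0 < b <= n)%N ->
  supported f -> supported (exch a b f).
Proof.
move=> /andP[a0 an] /andP[b0 bn] [f0 fn]; rewrite /exch; split=> [|k nk].
  by rewrite !ltn_eqF.
by rewrite !gtn_eqF ?(leq_ltn_trans _ nk) // fn.
Qed.

(** A [Post] move at r = 1 would reach the dummy letter 0. At the upper end a [Pre] move needs an L
    at r + 2, which therefore is at most n. *)
Lemma wpsi_supported c r f : (0 < r < n)%N -> (c = Post -> (1 < r)%N) ->
  supported f -> supp_res (wpsi c r f).
Proof.
move=> /andP[r0 rn] cP sf.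
have rb : (0 < r <= n)%N by rewrite r0 ltnW.
rewrite /wpsi; case: ifP => [_|_]; first exact: exch_supported.
case: c cP => cP //; case: ifP => //= /andP[_ f2]; apply: exch_supported => //.
  exact: supported_le f2.
by have := cP erefl; case: (r) rn => [|[|q]] //= rn _; rewrite ltnW // ltnW.
Qed.

Lemma wy_supported c r f : (0 < r <= n)%N -> (c = Post -> (1 < r)%N) ->
  supported f -> supp_res (wy c r f).
Proof.
move=> rb cP sf.
rewrite /wy; case: c cP => cP //; case: ifP => //= /andP[_ f2].
  by apply: exch_supported => //=; apply: supported_le f2.
have r1 := cP erefl; apply: exch_supported => //; case/andP: rb => _ rn.
by case: (r) r1 rn => [|[|q]] //= _ rn; rewrite ltnW.
Qed.

End Encoding.
Arguments bvec {F n} f.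
Arguments wop F n T : clear implicits.

Section Representation.
Variables (F : fieldType) (e n : nat) (kappa1 kappa2 : 'Z_e).
Hypothesis he : (3 <= e)%N.
Hypothesis hkappa : kappa2 <> kappa1 - 1.
Hypothesis hmod : n%:R = kappa2 - kappa1 + 1 :> 'Z_e.

Local Notation cls_ k := (@gap_cls e n k).
Local Notation res_seq := {ffun 'I_n -> 'Z_e}.
Local Notation mx := 'M[F]_(#|{: fword n}|.-1.+1).

Definition res (f : word) : res_seq := [ffun i : 'I_n => wres n kappa2 f i.+1].

Definition we (i : res_seq) (f : word) : option (bool * word) :=
  if res f == i then Some (false, f) else None.

Definition gen_mx (g : klr_gen e n) : mx :=
  match g with
  | inl (inl i) => wop F n (we i)
  | inl (inr r) => wop F n (wy (cls_ r.+1) r.+1)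
  | inr r => wop F n (wpsi (cls_ r.+1) r.+1)
  end.

Lemma n_neq0 : (n%:R : 'Z_e) != 0.
Proof.
apply/eqP => n0; apply: hkappa; apply/eqP; rewrite -subr_eq0.
have -> : kappa2 - (kappa1 - 1) = kappa2 - kappa1 + 1 by ring.
by rewrite -hmod n0.
Qed.

(** If position 1 were [Post], then n - 1 = -1 and n = 0 in Z/e, against kappa2 <> kappa1 - 1. *)
Lemma cls_post k : cls_ k.+1 = Post -> (0 < k)%N.
Proof.
case: k => //; rewrite /gap_cls; do 2 case: ifP => // _; case: eqP => // E _.
by case/eqP: n_neq0; apply: (addIr (-1)); rewrite add0r; exact: E.
Qed.

Definition mon_mx (k : {fmonom klr_gen e n}) : mx :=
  foldr (fun g A => gen_mx g * A) 1 (k : seq _).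

Fact mon_mx_morph : mmorphism mon_mx.
Proof.
split=> [k l|]; last by rewrite /mon_mx fm1.
rewrite /mon_mx fmM foldr_cat; elim: (k : seq _) => [|g s IH] /=.
  by rewrite mul1r.
by rewrite IH mulrA.
Qed.
HB.instance Definition _ := isMultiplicative.Build _ _ mon_mx mon_mx_morph.

Definition free_rep : klr_free F e n -> mx := mmap (@scalar_mx F _) mon_mx.
Fact free_rep_zmod : zmod_morphism free_rep.
Proof. exact: raddfB. Qed.
Fact free_rep_monoid : monoid_morphism free_rep.
Proof.
have [|HM H1] := @commr_mmap_is_multiplicative {fmonom klr_gen e n} F mx (@scalar_mx F _) mon_mx.
  by move=> g k l; apply: comm_scalar_mx.
by split=> // x y; apply: HM.
Qed.

Lemma free_rep_gen g : free_rep (free_gen F g) = gen_mx g.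
Proof.
by rewrite /free_rep /free_gen mmapU /= mul1r /mon_mx fmU /= mulr1.
Qed.

HB.instance Definition _ :=
  GRing.isZmodMorphism.Build (klr_free F e n) mx free_rep free_rep_zmod.
HB.instance Definition _ :=
  GRing.isMonoidMorphism.Build (klr_free F e n) mx free_rep free_rep_monoid.

Let W_e i := wop F n (we i).
Let W_y (r : 'I_n) := wop F n (wy (cls_ r.+1) r.+1).
Let W_psi (r : 'I_n.-1) := wop F n (wpsi (cls_ r.+1) r.+1).

Let rep_e i : free_rep (free_e F i) = W_e i. Proof. exact: free_rep_gen. Qed.
Let rep_y r : free_rep (free_y F e r) = W_y r. Proof. exact: free_rep_gen. Qed.
Let rep_psi r : free_rep (free_psi F e r) = W_psi r. Proof. exact: free_rep_gen. Qed.

Let frM a b : free_rep (a * b) = free_rep a * free_rep b.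
Proof. exact: rmorphM. Qed.
Let frD a b : free_rep (a + b) = free_rep a + free_rep b.
Proof. exact: rmorphD. Qed.
Let frB a b : free_rep (a - b) = free_rep a - free_rep b.
Proof. exact: rmorphB. Qed.

Let frN k : free_rep k%:R = k%:R.
Proof. exact: rmorph_nat. Qed.

Lemma bvec_ext (w : fword n) : basis F w = bvec (ext w).
Proof. by rewrite /bvec extK. Qed.

Lemma wop_eqP (A B : mx) :
  (forall f, supported n f -> A *m bvec f = B *m bvec f) -> A = B.
Proof.
by move=> H; apply: mx_eqP => w; rewrite bvec_ext; apply: H; apply: ext_supported.
Qed.

Let W_eE i f : supported n f -> W_e i *m bvec f = if res f == i then bvec f else 0.
Proof. by move=> sf; rewrite wop_bvec // /we; case: ifP. Qed.

Let psi_supp (r : 'I_n.-1) f : supported n f -> supp_res n (wpsi (cls_ r.+1) r.+1 f).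
Proof.
move=> sf; apply: wpsi_supported => //; first exact: hi_subproof.
by move/cls_post.
Qed.

Let y_supp (r : 'I_n) f : supported n f -> supp_res n (wy (cls_ r.+1) r.+1 f).
Proof.
move=> sf; apply: wy_supported => //; first exact: ltn_ord.
by move/cls_post.
Qed.

Let W_psiE r f : supported n f ->
  W_psi r *m bvec f = wvec bvec (wpsi (cls_ r.+1) r.+1 f).
Proof. exact: wop_bvec. Qed.

Let W_yE r f : supported n f ->
  W_y r *m bvec f = wvec bvec (wy (cls_ r.+1) r.+1 f).
Proof. exact: wop_bvec. Qed.

Let W_eW i x f : supp_res n x -> (forall s f', x = Some (s, f') -> res f' = res f) ->
  W_e i *m wvec bvec x = if res f == i then wvec bvec x else 0.
Proof.
case: x => [[s f']|] /= sx H; last by rewrite mulmx0; case: ifP.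
rewrite -(H s f' erefl); case: s {H}; rewrite ?mulmxN W_eE //; case: ifP => //.
by rewrite oppr0.
Qed.

Let bind_supp x T : (forall f, supported n f -> supp_res n (T f)) -> supp_res n x ->
  supp_res n (wbind x T).
Proof.
by case: x => [[s f]|] //= H /H; case: (T f) => [[]|].
Qed.

Let cls_succ k : succ_cls (cls_ k) (cls_ k.+1).
Proof. exact: gap_cls_succ. Qed.

Let WW (A B : mx) (v : 'cV[F]__) : (A * B) *m v = A *m (B *m v).
Proof. by rewrite -mulmxE mulmxA. Qed.

Lemma res_psi (r : 'I_n.-1) f s f' : wpsi (cls_ r.+1) r.+1 f = Some (s, f') ->
  res f' = swap_res r (res f).
Proof.
move=> E; apply/ffunP => k; rewrite !ffunE.
rewrite (wres_psi kappa2 he _ (ltn0Sn _) E) /nat_swap !eqSS; congr wres.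
case: tpermP => [->|->|/eqP lk /eqP hk] /=; rewrite ?eqxx //.
  by rewrite eqn_leq ltnn.
by rewrite -[_ == r :> nat]/(k == lo r) -[_ == r.+1]/(k == hi r) (negPf lk) (negPf hk).
Qed.

Lemma res_y (r : 'I_n) f s f' : wy (cls_ r.+1) r.+1 f = Some (s, f') ->
  res f' = res f.
Proof. by move=> E; apply/ffunP => k; rewrite !ffunE (wres_y kappa2 he _ (ltn0Sn _) E). Qed.

Lemma swap_resK (r : 'I_n.-1) : involutive (swap_res (e := e) r).
Proof. by move=> i; apply/ffunP => k; rewrite !ffunE tpermK. Qed.

Let W_ewpsi i r f : supported n f ->
  W_e (swap_res r i) *m (W_psi r *m bvec f) =
  if res f == i then W_psi r *m bvec f else 0.
Proof.
move=> sf; rewrite W_psiE //; have := psi_supp r sf; have := @res_psi r f.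
case: (wpsi _ _ f) => [[s f']|] //= H sf'; last by rewrite mulmx0; case: ifP.
rewrite -(inj_eq (can_inj (swap_resK r))) -(H _ _ erefl).
by case: s {H}; rewrite ?mulmxN W_eE //; case: ifP => //; rewrite oppr0.
Qed.

(** Both sides are applied to a supported word. A right factor e(i) leaves only the words with
    residue sequence i, for which the conditions on residues become conditions on letters, and the
    relations between moves apply. *)
Lemma free_rep_rel l r : klr_rel l r -> free_rep l = free_rep r.
Proof.
have Hc := cls_succ.
case=> {l r} [i j||r i|r i|r s|r s sl sh|r s rs|r i|r i|r i|r s i sr].
- rewrite [LHS]frM 2!rep_e; apply: wop_eqP => f sf.
  rewrite WW W_eE //; case: (i =P j) => [<-|ij].
    by case: (res f =P i) => [fj|fj]; rewrite rep_e ?mulmx0 W_eE // ?fj ?eqxx //; case: eqP.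
  rewrite raddf0 mul0mx; case: (res f =P j) => [fj|fj]; last by rewrite mulmx0.
  by rewrite W_eE //; case: eqP => // fi; case: ij; rewrite -fi.
- apply: wop_eqP => f sf.
  rewrite rmorph1 mul1mx raddf_sum mulmx_suml (bigD1 (res f)) //=.
  rewrite rep_e W_eE // eqxx big1 ?addr0 // => j jf.
  by rewrite rep_e W_eE // eq_sym (negPf jf).
- rewrite [LHS]frM [RHS]frM rep_e rep_y; apply: wop_eqP => f sf.
  rewrite [LHS]WW [RHS]WW W_eE // W_yE // (@W_eW _ _ f); first 1 last.
  + exact: y_supp.
  + by move=> s f'; apply: res_y.
  by case: ifP => _; rewrite ?mulmx0 // W_yE.
- rewrite [LHS]frM [RHS]frM 2!rep_e rep_psi; apply: wop_eqP => f sf.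
  rewrite [LHS]WW [RHS]WW W_ewpsi // W_eE //.
  by case: ifP => _; rewrite ?mulmx0.
- rewrite [LHS]frM [RHS]frM 2!rep_y; apply: wop_eqP => f sf.
  rewrite [LHS]WW [RHS]WW 2?W_yE // 2?wop_wvec; try exact: y_supp.
  exact: wy_y.
- rewrite [LHS]frM [RHS]frM rep_psi rep_y; apply: wop_eqP => f sf.
  rewrite [LHS]WW [RHS]WW W_yE // W_psiE // 2?wop_wvec; try exact: y_supp; try exact: psi_supp.
  by apply/esym/(wpsi_y Hc) => // [] [E]; [case/eqP: sl|case/eqP: sh]; apply: val_inj.
- rewrite [LHS]frM [RHS]frM 2!rep_psi; apply: wop_eqP => f sf.
  rewrite [LHS]WW [RHS]WW 2?W_psiE // 2?wop_wvec; try exact: psi_supp.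
  by case/orP: rs => rs; [apply/esym|]; apply: (wpsi_psi Hc).
- rewrite [LHS]frM [in LHS]frM [RHS]frM frD [in RHS]frM frN rep_psi 2!rep_y rep_e.
  apply: wop_eqP => f sf; rewrite [LHS]WW [RHS]WW W_eE //.
  case: eqP => [fi|_]; last by rewrite !mulmx0.
  rewrite WW mulmxDl WW W_yE // W_psiE // 2?wop_wvec; try exact: y_supp; try exact: psi_supp.
  rewrite (wpsi_y_hi Hc) //; congr (_ + _).
  rewrite -fi !ffunE wres_eq //; case: (if _ is Crit then _ else _); last by rewrite mul0mx.
  by rewrite mul1mx.
- rewrite [LHS]frM [in LHS]frM [RHS]frM frD [in RHS]frM frN rep_psi 2!rep_y rep_e.
  apply: wop_eqP => f sf; rewrite [LHS]WW [RHS]WW W_eE //.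
  case: eqP => [fi|_]; last by rewrite !mulmx0.
  rewrite WW mulmxDl WW W_yE // W_psiE // 2?wop_wvec; try exact: y_supp; try exact: psi_supp.
  rewrite (wy_hi_psi Hc) //; congr (_ + _).
  rewrite -fi !ffunE wres_eq //; case: (if _ is Crit then _ else _); last by rewrite mul0mx.
  by rewrite mul1mx.
- rewrite [LHS]frM [in LHS]frM [RHS]frM rep_psi rep_e.
  apply: wop_eqP => f sf; rewrite [LHS]WW [RHS]WW W_eE //.
  case: eqP => [fi|_]; last by rewrite !mulmx0.
  rewrite WW W_psiE // wop_wvec; try exact: psi_supp.
  rewrite (wpsi_sq Hc) // (sq_rhsE n kappa2 he) /= -fi !ffunE /psi_sq_coef.
  case: ifP => _; first by rewrite raddf0 mul0mx.
  case: ifP => _; first by rewrite frB 2!rep_y mulmxBl !W_yE.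
  case: ifP => _; first by rewrite frB 2!rep_y mulmxBl !W_yE.
  by rewrite rmorph1 mul1mx.
- rewrite [LHS]frM [in LHS]frM [in X in X * _]frM [RHS]frM frD.
  rewrite [in RHS]frM [in X in X * _ + _]frM 2!rep_psi rep_e.
  apply: wop_eqP => f sf; rewrite [LHS]WW [RHS]WW W_eE //.
  case: eqP => [fi|_]; last by rewrite !mulmx0.
  rewrite 2!WW mulmxDl 2!WW 2?W_psiE //.
  do 4 (rewrite wop_wvec; [|try exact: psi_supp; try by apply: bind_supp;
    [exact: psi_supp|exact: psi_supp]]).
  rewrite /= sr (wbraid Hc) // (braid_rhsE n kappa2 he); congr (_ + _).
  rewrite -fi !ffunE /braid_coef /= sr.
  case: ifP => _; first by rewrite rmorph1 mul1mx.
  case: ifP => _; first by rewrite rmorphN1 mulNmx mul1mx.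
  by rewrite raddf0 mul0mx.
Qed.

End Representation.

(** * Universal properties of presented algebras and cyclic modules *)

Section Lifting.
Variables (A B : pzRingType) (rel : A -> A -> Prop) (g : {rmorphism A -> B}).
Hypothesis g_rel : forall l r, rel l r -> g l = g r.

Fact kernel_submod_closed : GRing.submod_closed [pred x : A^o | g x == 0].
Proof.
split=> [|a x y]; rewrite !inE ?rmorph0 // => /eqP gx /eqP gy.
by rewrite rmorphD rmorphM gx gy mulr0 addr0.
Qed.

Lemma ideal_gen_kernel x : x \in ideal_gen rel -> g x = 0.
Proof.
rewrite inE => /asboolP /(_ (Submodule kernel_submod_closed)) H; apply/eqP.
apply: H => [y a|l r /g_rel E]; rewrite !inE.
  by rewrite rmorphM => /eqP->; rewrite mul0r.
by rewrite rmorphB E subrr.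
Qed.

Let lift (x : presented_alg rel) : B := g (repr (x : quot_mod (ideal_gen rel))).

Let liftE x : lift (pi_alg rel x) = g x.
Proof.
apply/eqP; rewrite -subr_eq0 -rmorphB; apply/eqP/ideal_gen_kernel.
by apply/pi_algP; rewrite pi_algK.
Qed.

Lemma presented_alg_lift :
  exists h : {rmorphism presented_alg rel -> B}, forall x, h (pi_alg rel x) = g x.
Proof.
have lift_zmod : zmod_morphism lift.
  move=> x y; rewrite -[x]pi_algK -[y]pi_algK -raddfB !liftE.
  exact: rmorphB.
have lift_mon : monoid_morphism lift.
  split=> [|x y]; first by rewrite -[1](rmorph1 (pi_alg rel)) liftE rmorph1.
  by rewrite -[x]pi_algK -[y]pi_algK -rmorphM !liftE rmorphM.
pose lz := GRing.isZmodMorphism.Build _ _ lift lift_zmod.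
pose lm := GRing.isMonoidMorphism.Build _ _ lift lift_mon.
by exists (HB.pack_for {rmorphism presented_alg rel -> B} lift lz lm).
Qed.

End Lifting.

Section CyclicLift.
Local Open Scope quotient_scope.
Variables (R : pzRingType) (X : R -> Prop).

Let pi (a : R) : cyclic_mod X := \pi_(quot_mod (gen_submod (X : R^o -> Prop))) a.

Let piE a : pi a = a *: cyclic_gen X.
Proof. by rewrite /cyclic_gen [RHS]pi_quotZ /pi -[a in LHS]mulr1. Qed.

Lemma cyclic_modE (x : cyclic_mod X) : exists a, x = a *: cyclic_gen X.
Proof.
exists (repr (x : quot_mod (gen_submod (X : R^o -> Prop)))).
by rewrite -piE /pi reprK.
Qed.

Lemma cyclic_mod_eq0 a : X a -> a *: cyclic_gen X = 0.
Proof.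
move=> Xa; rewrite -piE -(scale0r (cyclic_gen X)) -piE; apply/quot_modP.
by rewrite subr0 inE; apply/asboolP => U; apply.
Qed.

Section Map.
Variables (V : zmodType) (phi : {additive R -> V}).
Hypothesis phi_ker : forall a b, phi b = 0 -> phi (a * b) = 0.
Hypothesis phi_X : forall a, X a -> phi a = 0.

Fact map_submod_closed : GRing.submod_closed [pred x : R^o | phi x == 0].
Proof.
split=> [|a x y]; rewrite !inE ?raddf0 // => /eqP px /eqP py.
by rewrite raddfD (phi_ker _ px) py addr0.
Qed.

Lemma gen_submod_kernel x : x \in gen_submod (X : R^o -> Prop) -> phi x = 0.
Proof.
rewrite inE => /asboolP /(_ (Submodule map_submod_closed)) H; apply/eqP.
by apply: H => y Xy; rewrite inE phi_X.
Qed.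

(** The target is only an additive group, because the column vectors carry no declared module
    structure over the algebra; [phi_ker] says that the kernel of [phi] is a left ideal. *)
Lemma cyclic_map :
  exists f : {additive cyclic_mod X -> V}, forall a, f (a *: cyclic_gen X) = phi a.
Proof.
pose f (x : cyclic_mod X) := phi (repr (x : quot_mod (gen_submod (X : R^o -> Prop)))).
have fE a : f (pi a) = phi a.
  apply/eqP; rewrite -subr_eq0 -raddfB; apply/eqP/gen_submod_kernel.
  by apply/quot_modP; rewrite reprK.
have f_zmod : zmod_morphism f.
  move=> x y; have [[a ->] [b ->]] := (cyclic_modE x, cyclic_modE y).
  by rewrite -scalerBl -!piE !fE raddfB.
pose fz := GRing.isZmodMorphism.Build _ _ f f_zmod.
by exists (HB.pack_for {additive cyclic_mod X -> V} f fz) => a; rewrite -piE [LHS]fE.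
Qed.
End Map.

Lemma cyclic_lift (V : lmodType R) (v : V) : (forall a, X a -> a *: v = 0) ->
  exists f : {linear cyclic_mod X -> V}, f (cyclic_gen X) = v.
Proof.
move=> Xv; have h_zmod : zmod_morphism (fun a : R => a *: v).
  by move=> a b; rewrite scalerBl.
pose hz := GRing.isZmodMorphism.Build _ _ _ h_zmod.
pose h : {additive R -> V} := HB.pack_for {additive R -> V} (fun a : R => a *: v) hz.
have [|//|f fE] := @cyclic_map V h.
  by move=> a b /= bv; rewrite -scalerA bv scaler0.
have f_scal : scalable f.
  move=> a x; have [b ->] := cyclic_modE x.
  by rewrite scalerA !fE /= scalerA.
pose fs := GRing.isScalable.Build _ _ _ _ f f_scal.
pose fz := GRing.isZmodMorphism.Build _ _ f (raddfB f).
exists (HB.pack_for {linear cyclic_mod X -> V} (f : _ -> _) fz fs).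
by rewrite -[cyclic_gen X]scale1r [LHS]fE /= scale1r.
Qed.

End CyclicLift.

(** * Scalars in the cyclotomic algebra and induction on its elements *)

Lemma malgC_comm (K : monomType) (R : comNzRingType) (c : R) (g : {malg R[K]}) :
  c%:MP * g = g * c%:MP.
Proof.
rewrite !malgM_def fgmulUg fgmulgU; apply: eq_bigr => k _.
by rewrite mulrC mul1m mulm1.
Qed.

Section Scalars.
Variables (F : fieldType) (e n : nat) (kappa1 kappa2 : 'Z_e).
Local Notation A := (cyclo_alg F n kappa1 kappa2).

Definition cyclo_pi (a : klr_free F e n) : A :=
  pi_alg (cyclo_rel kappa1 kappa2) (pi_alg (@klr_rel F e n) a).
Definition cyclo_scal (c : F) : A := cyclo_pi (c%:MP).

Lemma cyclo_piD a b : cyclo_pi (a + b) = cyclo_pi a + cyclo_pi b.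
Proof. by rewrite /cyclo_pi !raddfD. Qed.
Lemma cyclo_piM a b : cyclo_pi (a * b) = cyclo_pi a * cyclo_pi b.
Proof. by rewrite /cyclo_pi !rmorphM. Qed.

Lemma cyclo_scalD c c' : cyclo_scal (c + c') = cyclo_scal c + cyclo_scal c'.
Proof. by rewrite /cyclo_scal raddfD cyclo_piD. Qed.
Lemma cyclo_scalM c c' : cyclo_scal (c * c') = cyclo_scal c * cyclo_scal c'.
Proof. by rewrite /cyclo_scal rmorphM cyclo_piM. Qed.
Lemma cyclo_scal1 : cyclo_scal 1 = 1.
Proof. by rewrite /cyclo_scal /cyclo_pi !rmorph1. Qed.
Lemma cyclo_scal0 : cyclo_scal 0 = 0.
Proof. by rewrite /cyclo_scal /cyclo_pi !raddf0. Qed.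
Lemma cyclo_scalN c : cyclo_scal (- c) = - cyclo_scal c.
Proof. by apply: (addIr (cyclo_scal c)); rewrite -cyclo_scalD !addNr cyclo_scal0. Qed.

Lemma cyclo_piP (x : A) : exists a, x = cyclo_pi a.
Proof.
by exists (repr (repr x : quot_mod (ideal_gen (@klr_rel F e n)))); rewrite /cyclo_pi !pi_algK.
Qed.

Lemma cyclo_scal_comm c (x : A) : cyclo_scal c * x = x * cyclo_scal c.
Proof.
have [a ->] := cyclo_piP x; pose cc : klr_free F e n := c%:MP.
have E : cc * a = a * cc by apply: malgC_comm.
by rewrite -[cyclo_scal c]/(cyclo_pi cc) -cyclo_piM E cyclo_piM.
Qed.

(** An element lifts to the free algebra, where it is a finite sum of scalar multiples of monomials,
    and these are built one generator at a time. *)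
Lemma cyclo_alg_ind (P : A -> Prop) :
    (forall c, P (cyclo_scal c)) -> (forall x y, P x -> P y -> P (x + y)) ->
    (forall x y, P x -> P y -> P (x * y)) ->
    (forall i, P (cyclo_e F kappa1 kappa2 i)) ->
    (forall r, P (cyclo_y F kappa1 kappa2 r)) ->
    (forall r, P (cyclo_psi F kappa1 kappa2 r)) ->
  forall x, P x.
Proof.
move=> Pc PD PM Pe Py Ppsi x; have [a ->] := cyclo_piP x.
have Pgen g : P (cyclo_pi (free_gen F g)).
  by case: g => [[i|r]|r]; [apply: Pe|apply: Py|apply: Ppsi].
have Pmon (s : seq (klr_gen e n)) c : P (cyclo_pi << c *g FMonom s >>).
  elim: s => [|g s IH].
    have -> : FMonom [::] = mone :> {fmonom klr_gen e n} by apply: val_inj; rewrite /= fm1.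
    exact: Pc.
  have -> : << c *g FMonom (g :: s) >> = free_gen F g * << c *g FMonom s >>.
    rewrite malgM_def fgmulUU mul1r; congr (<< _ *g _ >>).
    by apply: val_inj; rewrite /= fmM fmU.
  by rewrite cyclo_piM; apply: PM.
rewrite [a]monalgE; elim/big_ind: _ => [|b b' Pb Pb'|[s] _]; last exact: Pmon.
  by have := Pc 0; rewrite /cyclo_scal raddf0.
by rewrite cyclo_piD; apply: PD.
Qed.

End Scalars.

Section Representation.
Variables (F : fieldType) (e n : nat) (kappa1 kappa2 : 'Z_e).
Hypothesis he : (3 <= e)%N.
Hypothesis hkappa : kappa2 <> kappa1 - 1.
Hypothesis hmod : n%:R = kappa2 - kappa1 + 1 :> 'Z_e.
Local Notation cls_ k := (@gap_cls e n k).
Local Notation mx := 'M[F]_(#|{: fword n}|.-1.+1).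

(** Position 1 is not [Post]. If it is critical, y_1 turns an initial AL into LA and then kills the
    result. *)
Lemma wy_first f : ~~ f 0%N ->
  wbind (wy (cls_ 1) 1 f) (wy (cls_ 1) 1) = None.
Proof.
move=> f0; have := @cls_post e n kappa1 kappa2 hkappa hmod 0; rewrite /wy.
case: gap_clsP => [g|g|g|g0 g1 gN1] //=; last by move/(_ erefl).
by case: ifP => // /andP[f1 f2] /=; rewrite /exch /= f2.
Qed.

Lemma cyclo_rep : exists rho : {rmorphism cyclo_alg F n kappa1 kappa2 -> mx},
  [/\ forall i, rho (cyclo_e F kappa1 kappa2 i) = wop F n (we kappa2 i),
      forall r, rho (cyclo_y F kappa1 kappa2 r) = wop F n (wy (cls_ r.+1) r.+1),
      forall r, rho (cyclo_psi F kappa1 kappa2 r) = wop F n (wpsi (cls_ r.+1) r.+1)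
    & forall c, rho (cyclo_scal n kappa1 kappa2 c) = c%:M].
Proof.
have [h1 h1E] := presented_alg_lift (@free_rep_rel F e n kappa1 kappa2 he hkappa hmod).
have h1e i : h1 (klr_e F i) = wop F n (we kappa2 i).
  by rewrite /klr_e h1E; apply: free_rep_gen.
have h1y r : h1 (klr_y F e r) = wop F n (wy (cls_ r.+1) r.+1).
  by rewrite /klr_y h1E; apply: free_rep_gen.
have [|h2 h2E] := @presented_alg_lift (klr_alg F e n) mx (@cyclo_rel F e n kappa1 kappa2) h1.
  move=> _ _ [r i r0]; rewrite rmorph0 rmorphM rmorphXn /= h1e h1y.
  apply: wop_eqP => f sf; rewrite mul0mx -mulmxE -mulmxA wop_bvec // /we.
  case: eqP => [fi|_] /=; last by rewrite mulmx0.
  have ws : supp_res n (wy (cls_ 1) 1 f).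
    have r1 := ltn_ord r; rewrite r0 in r1.
    by apply: wy_supported; rewrite // => /(cls_post hkappa hmod).
  have [f0 _] := sf.
  rewrite -fi ffunE /wres r0 leg_countS /leg_count big_ord0 add0n (negPf f0) subr0.
  rewrite /cyclo_exp; case E: (wy (cls_ 1) 1 f) ws => [x|] /= ws; last first.
    (* Here y_1 kills f, so a positive exponent suffices: the first residue is kappa2 for L and
       kappa1 for A. *)
    set c := (_ + _)%N; have : (0 < c)%N.
      rewrite addn_gt0 !lt0b; case: (f 1%N); first by rewrite subr0 eqxx orbT.
      by rewrite /gap hmod; apply/orP; left; apply/eqP; ring.
    by case: c => // c _; rewrite exprSr -mulmxE -mulmxA wop_bvec // E mulmx0.
  (* Here y_1 does not kill f, so position 1 is critical. Then kappa1 = kappa2, the exponent is 2,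
     and [wy_first] applies. *)
  have g0 : gap e n 1 = 0 :> 'Z_e.
    have := @cls_post e n kappa1 kappa2 hkappa hmod 0; move: E; rewrite /wy.
    by case: gap_clsP => // _ _ /(_ erefl).
  have -> : kappa2 = kappa1 by apply/eqP; rewrite -subr_eq0; move/eqP: g0; rewrite /gap hmod addrK.
  rewrite g0 if_same subr0 eqxx expr2 -mulmxE -mulmxA wop_bvec // E wop_wvec //.
  by rewrite -E wy_first.
exists h2; split.
- by move=> i; rewrite /cyclo_e h2E h1e.
- by move=> r; rewrite /cyclo_y h2E h1y.
- by move=> r; rewrite /cyclo_psi h2E /klr_psi h1E; apply: free_rep_gen.
- move=> c; rewrite /cyclo_scal /cyclo_pi h2E h1E; apply: mmapC.
Qed.
End Representation.

(** * The defining relations in the cyclotomic algebra *)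

Section Relations.
Variables (F : fieldType) (e n : nat) (kappa1 kappa2 : 'Z_e).
Local Notation A := (cyclo_alg F n kappa1 kappa2).
Local Notation pi := (@cyclo_pi F e n kappa1 kappa2).
Local Notation E := (@cyclo_e F e n kappa1 kappa2).
Local Notation Y := (@cyclo_y F e n kappa1 kappa2).
Local Notation Psi := (@cyclo_psi F e n kappa1 kappa2).

Lemma cyclo_pi_rel l r : klr_rel l r -> pi l = pi r.
Proof.
move=> lr; congr (pi_alg _ _); apply/pi_algP; rewrite inE.
by apply/asboolP => J _; apply.
Qed.

Let piM a b : pi (a * b) = pi a * pi b. Proof. exact: cyclo_piM. Qed.
Let piM3 a b c : pi (a * b * c) = pi a * pi b * pi c.
Proof. by rewrite 2!piM. Qed.
Let piMD a b c : pi ((a + b) * c) = (pi a + pi b) * pi c.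
Proof. by rewrite piM cyclo_piD. Qed.
Let piM4 a b c d : pi (a * b * c * d) = pi a * pi b * pi c * pi d.
Proof. by rewrite 3!piM. Qed.
Let piMD4 a b c d t : pi ((a * b * c + d) * t) = (pi a * pi b * pi c + pi d) * pi t.
Proof. by rewrite piMD piM3. Qed.
Let pin k : pi k%:R = k%:R.
Proof. by rewrite /cyclo_pi !rmorph_nat. Qed.

Lemma cyclo_ee i j : E i * E j = if i == j then E i else 0.
Proof.
apply: etrans (esym (piM _ _)) (etrans (cyclo_pi_rel (klr_ee F i j)) _).
by case: ifP => // _; rewrite /cyclo_pi !raddf0.
Qed.

Lemma cyclo_psie r i : Psi r * E i = E (swap_res r i) * Psi r.
Proof.
exact: etrans (esym (piM _ _)) (etrans (cyclo_pi_rel (klr_psie F r i)) (piM _ _)).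
Qed.

Lemma cyclo_psiy r s : s != lo r -> s != hi r -> Psi r * Y s = Y s * Psi r.
Proof.
move=> sl sh.
exact: etrans (esym (piM _ _)) (etrans (cyclo_pi_rel (klr_psiy F e sl sh)) (piM _ _)).
Qed.

Lemma cyclo_psipsi (r s : 'I_n.-1) : (r.+1 < s)%N || (s.+1 < r)%N ->
  Psi r * Psi s = Psi s * Psi r.
Proof.
move=> rs.
exact: etrans (esym (piM _ _)) (etrans (cyclo_pi_rel (klr_psipsi F e rs)) (piM _ _)).
Qed.

Lemma cyclo_psiy_hi r i : Psi r * Y (hi r) * E i =
  (Y (lo r) * Psi r + (i (lo r) == i (hi r))%:R) * E i.
Proof.
apply: etrans (esym (piM3 _ _ _)) (etrans (cyclo_pi_rel (klr_psiy_hi F r i)) _).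
by apply: etrans (piMD _ _ _) _; rewrite piM pin.
Qed.

Lemma cyclo_ypsi_hi r i : Y (hi r) * Psi r * E i =
  (Psi r * Y (lo r) + (i (lo r) == i (hi r))%:R) * E i.
Proof.
apply: etrans (esym (piM3 _ _ _)) (etrans (cyclo_pi_rel (klr_ypsi_hi F r i)) _).
by apply: etrans (piMD _ _ _) _; rewrite piM pin.
Qed.

Lemma cyclo_psi_sq r i : Psi r * Psi r * E i =
  pi (psi_sq_coef F r (i (lo r)) (i (hi r))) * E i.
Proof.
exact: etrans (esym (piM3 _ _ _)) (etrans (cyclo_pi_rel (klr_psi_sq F r i)) (piM _ _)).
Qed.

Lemma cyclo_braid (r s : 'I_n.-1) i : s = r.+1 :> nat ->
  Psi r * Psi s * Psi r * E i =
  (Psi s * Psi r * Psi s + pi (braid_coef F n (i (lo r)) (i (hi r)) (i (hi s)))) * E i.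
Proof.
move=> sr; have H := cyclo_pi_rel (klr_braid F i sr).
exact: etrans (esym (piM4 _ _ _ _)) (etrans H (piMD4 _ _ _ _ _)).
Qed.

End Relations.

(** * Spanning *)

Section Words.
Local Open Scope nat_scope.
Variable n : nat.
Implicit Types (w : fword n) (r s : 'I_n.-1).

Definition swapw r w : fword n := [ffun k => w (tperm (lo r) (hi r) k)].
Definition LAat r w := w (lo r) && ~~ w (hi r).
Definition ALat r w := ~~ w (lo r) && w (hi r).
Definition pos w : nat := \sum_(k < n) k * w k.
Definition legs w : nat := \sum_(k < n) w k.
Definition hookw (m : nat) : fword n := [ffun k : 'I_n => (k < m)%N].

Lemma lo_neq_hi r : lo r != hi r.
Proof. by rewrite -val_eqE /= neq_ltn ltnSn. Qed.

Lemma swapw_lo r w : swapw r w (lo r) = w (hi r).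
Proof. by rewrite ffunE tpermL. Qed.
Lemma swapw_hi r w : swapw r w (hi r) = w (lo r).
Proof. by rewrite ffunE tpermR. Qed.
Lemma swapw_out r w k : k != lo r -> k != hi r -> swapw r w k = w k.
Proof. by move=> kl kh; rewrite ffunE tpermD // eq_sym. Qed.

Lemma swapwK r : involutive (swapw r).
Proof. by move=> w; apply/ffunP => k; rewrite !ffunE tpermK. Qed.

Lemma LA_swapw r w : LAat r (swapw r w) = ALat r w.
Proof. by rewrite /LAat swapw_lo swapw_hi andbC. Qed.
Lemma AL_swapw r w : ALat r (swapw r w) = LAat r w.
Proof. by rewrite /ALat swapw_lo swapw_hi andbC. Qed.

Lemma legs_swapw r w : legs (swapw r w) = legs w.
Proof.
rewrite /legs [RHS](reindex_inj (@perm_inj _ (tperm (lo r) (hi r)))).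
by apply: eq_bigr => k _; rewrite ffunE.
Qed.

Lemma pos_swapw r w : ALat r w -> pos w = (pos (swapw r w)).+1.
Proof.
move=> /andP[wl wh]; rewrite /pos.
have hl : hi r != lo r by rewrite eq_sym lo_neq_hi.
rewrite (bigD1 (lo r)) // (bigD1 (hi r)) //=.
rewrite [X in _ = X.+1](bigD1 (lo r)) // [X in (_ + X).+1](bigD1 (hi r)) //=.
rewrite swapw_lo swapw_hi wh (negPf wl) !muln0 !muln1 add0n add0n addSn.
congr _.+1; congr addn; apply: eq_bigr => k /andP[kl kh].
by rewrite swapw_out.
Qed.

Definition far r s := (r.+1 < s) || (s.+1 < r).

Lemma far_sym r s : far r s = far s r.
Proof. by rewrite /far orbC. Qed.

Lemma far_neq r s : far r s ->
  [/\ lo s != lo r, lo s != hi r, hi s != lo r & hi s != hi r].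
Proof. by rewrite /far -!val_eqE /=; move=> h; split; lia. Qed.

Lemma far_swapw r s w : far r s ->
  swapw r w (lo s) = w (lo s) /\ swapw r w (hi s) = w (hi s).
Proof. by move=> /far_neq[*]; rewrite !swapw_out. Qed.

Lemma swapwC r s w : far r s -> swapw r (swapw s w) = swapw s (swapw r w).
Proof.
move=> rs; have [ll lh hl hh] := far_neq rs.
have [ll' lh' hl' hh'] : [/\ lo r != lo s, lo r != hi s, hi r != lo s & hi r != hi s].
  by apply: far_neq; rewrite far_sym.
apply/ffunP => k; have [->|kl] := eqVneq k (lo r).
  by rewrite swapw_lo [RHS]swapw_out // swapw_lo swapw_out.
have [->|kh] := eqVneq k (hi r).
  by rewrite swapw_hi [RHS]swapw_out // swapw_hi swapw_out.
rewrite swapw_out //; have [->|kl'] := eqVneq k (lo s).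
  by rewrite !swapw_lo swapw_out.
have [->|kh'] := eqVneq k (hi s).
  by rewrite !swapw_hi swapw_out.
by rewrite !swapw_out.
Qed.

Variant adjacency r s : Prop :=
| AdjFar of far r s | AdjEq of r = s
| AdjUp of s = r.+1 :> nat | AdjDown of r = s.+1 :> nat.

Lemma far_or r s : adjacency r s.
Proof.
have [->|rs] := eqVneq r s; first exact: AdjEq.
case E: (far r s); first exact: AdjFar.
move: rs E; rewrite /far -val_eqE /= => rs E.
by have [rs'|sr] := ltnP r s; [apply: AdjUp|apply: AdjDown]; lia.
Qed.

Lemma lo_hi r s : s = r.+1 :> nat -> lo s = hi r.
Proof. by move=> sr; apply: val_inj; rewrite /= sr. Qed.

(** Two such places that were adjacent would share a letter, which would have to be both L and A. *)
Lemma AL_far r s w : ALat r w -> ALat s w -> r != s -> far r s.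
Proof.
move=> /andP[rl rh] /andP[sl sh] rs.
have [//|E|E|E] := far_or r s; first by rewrite E eqxx in rs.
  by rewrite (lo_hi E) rh in sl.
by rewrite (lo_hi E) sh in rl.
Qed.

Lemma legs_hookw m : (m <= n)%N -> legs (hookw m) = m.
Proof.
move=> mn; rewrite /legs (eq_bigr (fun k : 'I_n => nat_of_bool (k < m))%N); last first.
  by move=> k _; rewrite ffunE.
have -> : \sum_(k < n) (k < m) = minn n m; last by apply/minn_idPr.
elim: n => [|k IH]; first by rewrite big_ord0 min0n.
by rewrite big_ord_recr /= IH; lia.
Qed.

(** Without AL, every letter before an L is an L, so the letters L form an initial segment. *)
Lemma no_AL w : (forall r, ~~ ALat r w) -> w = hookw (legs w).
Proof.
move=> H.
have step (i j : 'I_n) : j = i.+1 :> nat -> w j -> w i.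
  move=> ji wj; have rn : (i < n.-1)%N by have := ltn_ord j; lia.
  have := H (Ordinal rn); rewrite /ALat negb_and negbK.
  have -> : lo (Ordinal rn) = i by apply: val_inj.
  have -> : hi (Ordinal rn) = j by apply: val_inj; rewrite /= ji.
  by rewrite wj orbF.
have anti d (i j : 'I_n) : (j = i + d :> nat)%N -> w j -> w i.
  elim: d j => [|d IH] j ji wj.
    by have -> : i = j by apply: val_inj; rewrite /= ji addn0.
  have jd : (i + d < n)%N by have := ltn_ord j; lia.
  by apply: (IH (Ordinal jd)) => //; apply: step wj; rewrite ji addnS.
(* The least such k is the length of the initial segment of letters L. *)
pose P k := [forall j : 'I_n, (k <= j)%N ==> ~~ w j].
have exP : exists k, P k.
  by exists n; apply/forallP => j; rewrite leqNgt ltn_ord.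
case: (ex_minnP exP) => c Pc cmin.
have wE : w = hookw c.
  apply/ffunP => j; rewrite ffunE; have [jc|cj] := ltnP j c; last first.
    by apply/negbTE; move/forallP/(_ j): Pc; rewrite cj.
  have : ~~ P c.-1.
    by apply/negP => /cmin; case: (c) jc => //= c' _; rewrite ltnn.
  rewrite negb_forall => /existsP[k]; rewrite negb_imply negbK => /andP[ck wk].
  have jk : (j <= k)%N by apply: leq_trans ck; rewrite -ltnS prednK // (leq_ltn_trans _ jc).
  by apply: (anti (k - j)%N _ k) => //; rewrite subnKC.
rewrite wE legs_hookw //; apply: cmin; apply/forallP => j.
by rewrite leqNgt ltn_ord.
Qed.

Lemma ALat_hookw m r : ~~ ALat r (hookw m).
Proof. by rewrite /ALat !ffunE /=; lia. Qed.

Lemma LAat_hookw m r : LAat r (hookw m) = (r.+1 == m).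
Proof. by rewrite /LAat !ffunE /=; lia. Qed.

End Words.

Section Scaling.
Variables (R : pzRingType) (V : lmodType R).
Implicit Types (a b c d t : R) (v : V).

(** Many relations carry a right factor e(i); these rules remove it on a vector that e(i) fixes. *)
Lemma scaler_fix a b v : b *: v = v -> (a * b) *: v = a *: v.
Proof. by rewrite -scalerA => ->. Qed.
Lemma scaler_fix2 a b c v : c *: v = v -> (a * b * c) *: v = a *: (b *: v).
Proof. by move=> cv; rewrite scaler_fix // scalerA. Qed.
Lemma scaler_fixD a b c d v : c *: v = v ->
  ((a * b + d) * c) *: v = a *: (b *: v) + d *: v.
Proof. by move=> cv; rewrite scaler_fix // scalerDl scalerA. Qed.
Lemma scaler_fix3 a b c d v : d *: v = v ->
  (a * b * c * d) *: v = a *: (b *: (c *: v)).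
Proof. by move=> dv; rewrite scaler_fix // !scalerA. Qed.
Lemma scaler_fixD3 a b c d t v : t *: v = v ->
  ((a * b * c + d) * t) *: v = a *: (b *: (c *: v)) + d *: v.
Proof. by move=> cv; rewrite scaler_fix // scalerDl !scalerA. Qed.
End Scaling.

Lemma cyclo_pi_y (F : fieldType) (e n : nat) (kappa1 kappa2 : 'Z_e) r :
  cyclo_pi kappa1 kappa2 (free_y F e r) = cyclo_y F kappa1 kappa2 r :> cyclo_alg F n _ _.
Proof. by []. Qed.

Local Opaque cyclo_e cyclo_y cyclo_psi cyclo_scal.

Section SpechtSpan.
Variables (F : fieldType) (e n : nat) (kappa1 kappa2 : 'Z_e) (m : nat).
Hypothesis hm : (m <= n)%N.
Local Notation A := (cyclo_alg F n kappa1 kappa2).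
Local Notation E := (@cyclo_e F e n kappa1 kappa2).
Local Notation Y := (@cyclo_y F e n kappa1 kappa2).
Local Notation Psi := (@cyclo_psi F e n kappa1 kappa2).
Local Notation scal := (@cyclo_scal F e n kappa1 kappa2).
Variables (S : lmodType A) (z : S).
Hypothesis specht_relE : forall a : A, specht_rel m a -> a *: z = 0.
Implicit Types (w : fword n).

Lemma specht_gen_e : E (hook_res n kappa1 kappa2 m) *: z = z.
Proof.
apply/eqP; rewrite -subr_eq0 -[X in _ - X]scale1r -scalerBl.
by rewrite specht_relE //; constructor.
Qed.

(* The standard basis vector of w, reached by some sequence of moves from LA to
   AL; by [svec_swap] the choice of the moves does not matter. *)
Fixpoint svec_rec k w : S :=
  if k is k'.+1 then
    if [pick r | ALat r w] is Some r then Psi r *: svec_rec k' (swapw r w) else z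
  else z.

Lemma svec_recS k w : svec_rec k.+1 w =
  if [pick r | ALat r w] is Some r then Psi r *: svec_rec k (swapw r w) else z.
Proof. by []. Qed.

Definition svec w := svec_rec (pos w) w.

Lemma svec_hook w : (forall r, ~~ ALat r w) -> svec w = z.
Proof.
move=> H; rewrite /svec; case: (pos w) => //= k; case: pickP => // r.
by rewrite (negPf (H r)).
Qed.

(** A diamond argument: two places with AL are far apart, so the two psi commute and both orders end
    in the same word. Induction on [pos] does the rest. *)
Lemma svec_swap r w : ALat r w -> svec w = Psi r *: svec (swapw r w).
Proof.
have [k] := ubnP (pos w); elim: k r w => // k IH r w wk rw.
have -> : svec w = if [pick t | ALat t w] is Some t then Psi t *: svec (swapw t w) else z.
  rewrite {1}/svec (pos_swapw rw) svec_recS; case: pickP => // t tw.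
  by congr (_ *: svec_rec _ _); apply: succn_inj; rewrite -(pos_swapw rw) (pos_swapw tw).
case: pickP => [t tw|/(_ r)]; last by rewrite rw.
have [->//|tr] := eqVneq t r.
have ftr := AL_far tw rw tr; have frt : far r t by rewrite far_sym.
have ALr : ALat r (swapw t w) by rewrite /ALat; have [-> ->] := far_swapw w ftr.
have ALt : ALat t (swapw r w) by rewrite /ALat; have [-> ->] := far_swapw w frt.
rewrite (IH r) //; last by rewrite -ltnS -(pos_swapw tw).
rewrite [in RHS](IH t) //; last by rewrite -ltnS -(pos_swapw rw).
by rewrite !scalerA (swapwC w ftr) cyclo_psipsi.
Qed.

(** The weight of z is carried along by psi_r e(i) = e(s_r i) psi_r. It supplies the idempotent that
    the relations depending on residues require. *)
Lemma svec_weight w : exists i, E i *: svec w = svec w.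
Proof.
have [k] := ubnP (pos w); elim: k w => // k IH w wk.
case: (pickP (fun r : 'I_n.-1 => ALat r w)) => [r rw|H]; last first.
  rewrite svec_hook; last by move=> r; rewrite H.
  by exists (hook_res n kappa1 kappa2 m); apply: specht_gen_e.
have [|i iE] := IH (swapw r w); first by rewrite -ltnS -(pos_swapw rw).
exists (swap_res r i); rewrite (svec_swap rw) scalerA -cyclo_psie -scalerA.
by rewrite iE.
Qed.

(** The bound on [pos] serves as the induction measure for rewriting in the standard basis. *)
Inductive sspan (l : nat) : S -> Prop :=
| Span0 : sspan l 0
| SpanD c w x of (pos w < l)%N & legs w = m & sspan l x :
    sspan l (scal c *: svec w + x).

Lemma sspanD l x y : sspan l x -> sspan l y -> sspan l (x + y).
Proof.
move=> Hx Hy; elim: Hx => [|c w u wl wm _ IH]; first by rewrite add0r.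
by rewrite -addrA; apply: SpanD.
Qed.

Lemma sspanZ l c x : sspan l x -> sspan l (scal c *: x).
Proof.
elim=> [|d w u wl wm _ IH]; first by rewrite scaler0; apply: Span0.
by rewrite scalerDr scalerA -cyclo_scalM; apply: SpanD.
Qed.

Lemma sspanN l x : sspan l x -> sspan l (- x).
Proof.
move=> Hx; rewrite -scaleN1r -(cyclo_scal1 F n kappa1 kappa2) -cyclo_scalN.
exact: sspanZ.
Qed.

Lemma sspan_svec l w : (pos w < l)%N -> legs w = m -> sspan l (svec w).
Proof.
move=> wl wm; rewrite -[svec w]scale1r -[1](cyclo_scal1 F n kappa1 kappa2).
by rewrite -[X in sspan _ X]addr0; apply: SpanD => //; apply: Span0.
Qed.

Lemma sspanM (g : A) l l' x :
  (forall w, (pos w < l)%N -> legs w = m -> sspan l' (g *: svec w)) ->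
  sspan l x -> sspan l' (g *: x).
Proof.
move=> H; elim=> [|c w u wl wm _ IH]; first by rewrite scaler0; apply: Span0.
rewrite scalerDr scalerA -cyclo_scal_comm -scalerA; apply: sspanD => //.
by apply: sspanZ; apply: H.
Qed.

Lemma sspanW l l' x : (l <= l')%N -> sspan l x -> sspan l' x.
Proof.
move=> ll; elim=> [|c w u wl wm _ IH]; first exact: Span0.
by apply: SpanD => //; apply: leq_trans ll.
Qed.

(* Except for psi r where w has LA, all y's and psi's lower the sum of the
   positions of the letters L; braid relations need both claims at once. *)
Let psi_ok l := forall w, (pos w < l)%N -> legs w = m ->
  forall r, ~~ LAat r w -> sspan (pos w) (Psi r *: svec w).
Let y_ok l := forall w, (pos w < l)%N -> legs w = m ->
  forall r, sspan (pos w) (Y r *: svec w).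

(** Where w has LA at r, psi_r gives a standard vector with [pos] larger by one, whence the bound
    [l.+1]. *)
Let psi_span l x r : psi_ok l -> sspan l x -> sspan l.+1 (Psi r *: x).
Proof.
move=> H; apply: sspanM => w wl wm; have [LA|/(H w wl wm r)] := boolP (LAat r w).
  have AL : ALat r (swapw r w) by rewrite AL_swapw.
  rewrite -[w](swapwK r) -(svec_swap AL); apply: sspan_svec.
    by rewrite (pos_swapw AL) swapwK ltnS.
  by rewrite legs_swapw.
by apply: sspanW; rewrite ltnW // ltnW.
Qed.

Let y_span l x r : y_ok l -> sspan l x -> sspan l (Y r *: x).
Proof.
move=> H; apply: sspanM => w wl wm; apply: sspanW (H w wl wm r).
exact: ltnW.
Qed.

Lemma no_AL_hook w : legs w = m -> (forall r, ~~ ALat r w) ->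
  w = hookw n m /\ svec w = z.
Proof. by move=> <- H; split; [apply: no_AL|apply: svec_hook]. Qed.

(** Write the vector as psi_s applied to a standard vector of smaller [pos] and move y past psi_s,
    at the cost of at most one multiple of that smaller vector. Without AL the vector is z, which y
    kills. *)
Let y_step l : psi_ok l -> y_ok l -> y_ok l.+1.
Proof.
move=> Hpsi Hy w wl wm r.
case: (pickP (fun r : 'I_n.-1 => ALat r w)) => [s sw|H]; last first.
  have [_ ->] := no_AL_hook wm (fun s => negbT (H s)).
  by rewrite specht_relE; [apply: Span0|constructor].
set w' := swapw s w; have pw := pos_swapw sw.
have w'l : (pos w' < l)%N by rewrite -ltnS -pw.
have w'm : legs w' = m by rewrite legs_swapw.
have pl t : sspan (pos w') (Y t *: svec w') by apply: Hy.
have Hpsi' : psi_ok (pos w') by move=> u ul; apply: Hpsi; apply: ltn_trans w'l.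
have [i iE] := svec_weight w'.
rewrite (svec_swap sw) -/w' pw.
have act := congr1 (fun a : A => a *: svec w').
have [->|rl] := eqVneq r (lo s).
  have := etrans (esym (scaler_fix2 _ _ iE)) (etrans (act _ _
    (cyclo_psiy_hi F kappa1 kappa2 s i)) (scaler_fixD _ _ _ iE)).
  move/(canLR (addrK _)) => <-; apply: sspanD; first exact: psi_span.
  apply: sspanN; case: (_ == _); last by rewrite scale0r; apply: Span0.
  by rewrite scale1r; apply: sspan_svec.
have [->|rh] := eqVneq r (hi s).
  rewrite (etrans (esym (scaler_fix2 _ _ iE)) (etrans (act _ _
    (cyclo_ypsi_hi F kappa1 kappa2 s i)) (scaler_fixD _ _ _ iE))).
  apply: sspanD; first exact: psi_span.
  case: (_ == _); last by rewrite scale0r; apply: Span0.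
  by rewrite scale1r; apply: sspan_svec.
by rewrite scalerA -cyclo_psiy // -scalerA; apply: psi_span.
Qed.

Let cyclo_piB a b : cyclo_pi kappa1 kappa2 (a - b : klr_free F e n) =
  cyclo_pi kappa1 kappa2 a - cyclo_pi kappa1 kappa2 b.
Proof. by rewrite /cyclo_pi !raddfB. Qed.

Let braid_pi_span l a b c x : sspan l x ->
  sspan l (cyclo_pi kappa1 kappa2 (braid_coef F n a b c) *: x).
Proof.
move=> Hx; rewrite /braid_coef /cyclo_pi; case: ifP => _.
  by rewrite !rmorph1 scale1r.
case: ifP => _; first by rewrite !rmorphN1 scaleN1r; apply: sspanN.
by rewrite !raddf0 scale0r; apply: Span0.
Qed.

(** The vector of w is psi_s psi_r applied to that of w'', and [pos w] is [pos w''] + 2. The braid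
    relation replaces psi_r psi_s psi_r by psi_s psi_r psi_s up to a multiple of the vector of w''.
    There the innermost psi_s lowers the bound, and the other two psi raise it by at most one
    each. *)
Let braid_span l r s w : psi_ok l -> (pos w < l.+1)%N -> legs w = m ->
    ALat s w -> ALat r (swapw s w) -> (s = r.+1 :> nat \/ r = s.+1 :> nat) ->
    ~~ LAat s (swapw r (swapw s w)) ->
  sspan (pos w) (Psi r *: svec w).
Proof.
move=> Hpsi wl wm sw rw' E LA; set w' := swapw s w in rw' LA *.
set w'' := swapw r w' in LA *.
have pw := pos_swapw sw; have pw' := pos_swapw rw'; rewrite -/w' in pw.
rewrite -/w'' in pw'; have w''l : (pos w'' < l)%N by lia.
have w''m : legs w'' = m by rewrite !legs_swapw.
have ok k : (k <= l)%N -> psi_ok k by move=> kl u ul; apply: Hpsi; apply: leq_trans ul kl.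
have step k t x : (k <= l)%N -> sspan k x -> sspan k.+1 (Psi t *: x).
  by move=> kl; apply: psi_span; apply: ok.
have sv : sspan (pos w) (svec w'') by apply: sspan_svec => //; lia.
rewrite (svec_swap sw) -/w' (svec_swap rw') -/w''.
have [i iE] := svec_weight w''.
have act := congr1 (fun a : A => a *: svec w'').
have main : sspan (pos w) (Psi s *: (Psi r *: (Psi s *: svec w''))).
  rewrite pw pw'; apply: (step); first by lia.
  by apply: step; [lia|apply: Hpsi].
case: E => E.
  rewrite (etrans (esym (scaler_fix3 _ _ _ iE)) (etrans (act _ _
    (cyclo_braid F kappa1 kappa2 i E)) (scaler_fixD3 _ _ _ _ iE))).
  by apply: sspanD => //; apply: braid_pi_span.
have := etrans (esym (scaler_fix3 _ _ _ iE)) (etrans (act _ _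
  (cyclo_braid F kappa1 kappa2 i E)) (scaler_fixD3 _ _ _ _ iE)).
move/(canLR (addrK _)) => <-; apply: sspanD => //; apply: sspanN.
exact: braid_pi_span.
Qed.

(** If w has AL at r, the quadratic relation applies. Otherwise choose another place s with AL:
    psi_s commutes with psi_r when s is far, and the braid relation applies when s is adjacent.
    Without any AL the vector is z, and psi_r kills it. *)
Let psi_step l : psi_ok l -> y_ok l -> psi_ok l.+1.
Proof.
move=> Hpsi Hy w wl0 wm r LA.
have sub k : (k < l.+1)%N -> psi_ok k.
  by move=> kl u ul; apply: Hpsi; apply: leq_trans ul _.
case: (boolP (ALat r w)) => [rw|AL].
  set w' := swapw r w; have pw := pos_swapw rw.
  have w'l : (pos w' < l)%N by rewrite -ltnS -pw.
  have w'm : legs w' = m by rewrite legs_swapw.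
  have [i iE] := svec_weight w'.
  have act := congr1 (fun a : A => a *: svec w').
  rewrite (svec_swap rw) -/w' pw.
  rewrite (etrans (esym (scaler_fix2 _ _ iE)) (etrans (act _ _
    (cyclo_psi_sq F kappa1 kappa2 r i)) (scaler_fix _ iE))).
  have yw t : sspan (pos w').+1 (Y t *: svec w').
    by apply: sspanW (leqnSn _) _; apply: Hy.
  rewrite /psi_sq_coef; case: ifP => _.
    by rewrite /cyclo_pi !raddf0 scale0r; apply: Span0.
  case: ifP => _.
    by rewrite cyclo_piB 2!cyclo_pi_y scalerBl; apply: sspanD; [|apply: sspanN]; apply: yw.
  case: ifP => _.
    by rewrite cyclo_piB 2!cyclo_pi_y scalerBl; apply: sspanD; [|apply: sspanN]; apply: yw.
  by rewrite /cyclo_pi !rmorph1 scale1r; apply: sspan_svec.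
case: (pickP (fun s : 'I_n.-1 => ALat s w)) => [s sw|H]; last first.
  have [wh ->] := no_AL_hook wm (fun s => negbT (H s)).
  rewrite specht_relE; first exact: Span0.
  by constructor; rewrite wh LAat_hookw in LA.
set w' := swapw s w; have pw := pos_swapw sw.
have w'l : (pos w' < l)%N by rewrite -ltnS -pw.
have w'm : legs w' = m by rewrite legs_swapw.
have [frs|E|E|E] := far_or r s.
- have fsr : far s r by rewrite far_sym.
  rewrite (svec_swap sw) -/w' pw scalerA cyclo_psipsi // -scalerA.
  apply: psi_span; first by apply: sub; apply: ltnW.
  apply: Hpsi => //; have [el eh] := far_swapw w fsr.
  by rewrite /LAat el eh.
- by rewrite E sw in AL.
(* From position r on, w reads AAL, which passes through ALA to LAA. *)
- have wh : ~~ w (hi r) by rewrite -(lo_hi E); case/andP: sw.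
  have wl : ~~ w (lo r) by move: LA; rewrite /LAat wh andbT.
  have ws : w (hi s) by case/andP: sw.
  have [nl nh] : lo r != lo s /\ lo r != hi s.
    by rewrite -!val_eqE /= E; split; lia.
  have rw' : ALat r w'.
    by rewrite /ALat /w' swapw_out // wl -(lo_hi E) swapw_lo.
  apply: (braid_span Hpsi wl0 wm sw rw' (or_introl E)); rewrite /LAat (lo_hi E) swapw_hi.
  by rewrite /w' (swapw_out _ nl nh) (negPf wl).
(* From position s on, w reads ALL, which passes through LAL to LLA. *)
- have wl : w (lo r) by rewrite (lo_hi E); case/andP: sw.
  have wh : w (hi r) by move: LA; rewrite /LAat wl negbK.
  have ws : ~~ w (lo s) by case/andP: sw.
  have [nl nh] : hi r != lo s /\ hi r != hi s.
    by rewrite -!val_eqE /= E; split; lia.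
  have rw' : ALat r w'.
    by rewrite /ALat /w' (lo_hi E) swapw_hi ws (swapw_out _ nl nh) wh.
  apply: (braid_span Hpsi wl0 wm sw rw' (or_intror E)); rewrite /LAat -(lo_hi E).
  by rewrite swapw_lo /w' (swapw_out _ nl nh) wh andbF.
Qed.

Let action_ok l : psi_ok l /\ y_ok l.
Proof.
elim: l => [|l [Hpsi Hy]]; first by split=> w.
by split; [apply: psi_step|apply: y_step].
Qed.

Lemma sspan_action (a : A) l x : sspan l x -> exists l', sspan l' (a *: x).
Proof.
move: a l x; apply: cyclo_alg_ind => [c|a b Ha Hb|a b Ha Hb|i|r|r] l x Hx.
- by exists l; apply: sspanZ.
- have [k Hk] := Ha l x Hx; have [k' Hk'] := Hb l x Hx.
  exists (maxn k k'); rewrite scalerDl; apply: sspanD.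
    by apply: sspanW Hk; apply: leq_maxl.
  by apply: sspanW Hk'; apply: leq_maxr.
- have [k Hk] := Hb l x Hx; have [k' Hk'] := Ha k _ Hk.
  by exists k'; rewrite -scalerA.
- exists l; apply: sspanM Hx => w wl wm; have [j jE] := svec_weight w.
  rewrite -jE scalerA cyclo_ee; case: eqP => [->|_].
    by rewrite jE; apply: sspan_svec.
  by rewrite scale0r; apply: Span0.
- by exists l; apply: y_span => //; have [] := action_ok l.
- by exists l.+1; apply: psi_span => //; have [] := action_ok l.
Qed.

Lemma svec_span (a : A) :
  exists c : fword n -> F, a *: z = \sum_(w | legs w == m) scal (c w) *: svec w.
Proof.
have Hz : sspan (pos (hookw n m)).+1 z.
  rewrite -(svec_hook (@ALat_hookw n m)); apply: sspan_svec => //.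
  exact: legs_hookw.
have [l] := sspan_action a Hz; elim=> [|d w x _ wm _ [c ->]].
  by exists (fun=> 0); rewrite big1 // => w _; rewrite cyclo_scal0 scale0r.
exists (fun u => (if u == w then d else 0) + c u).
rewrite [RHS](eq_bigr (fun u => (if u == w then scal d *: svec w else 0) + scal (c u) *: svec u)).
  rewrite big_split /=; congr (_ + _); rewrite (bigD1 w) ?wm //= eqxx big1 ?addr0 //.
  by move=> u /andP[_ /negPf->].
move=> u _; rewrite cyclo_scalD scalerDl; congr (_ + _); case: eqP => [->//|_].
by rewrite cyclo_scal0 scale0r.
Qed.

End SpechtSpan.

Lemma exchL a b f : exch a b f a = f b.
Proof. by rewrite /exch eqxx. Qed.
Lemma exchR a b f : exch a b f b = f a.
Proof. by rewrite /exch eqxx; case: eqP => [->|]. Qed.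
Lemma exchD a b f k : k != a -> k != b -> exch a b f k = f k.
Proof. by rewrite /exch => /negPf-> /negPf->. Qed.

(** * The homomorphism gamma and simplicity *)

Definition set_last (n : nat) (f : word) : word := fun k => if k == n then true else f k.
Definition wgam (n : nat) (f : word) : option (bool * word) :=
  if f n then None else Some (false, set_last n f).

Lemma wgam_hi n f h : wgam n (glue n h f) = wmap (glue n h) (wgam 0 f).
Proof.
have e0 := glue_hi n h f 0; rewrite addn0 in e0; rewrite /wgam e0; case: ifP => //= _.
congr (Some (_, _)); apply: funext => k; rewrite /set_last /glue.
have [->|kn] := eqVneq k n; first by rewrite ltnn subnn.
by case: (ltnP k n) => // nk; rewrite subn_eq0 leqNgt ltn_neqAle eq_sym kn nk.
Qed.

Section HookModule.
Variables (F : fieldType) (e n : nat) (kappa1 kappa2 : 'Z_e).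
Hypothesis he : (3 <= e)%N.
Hypothesis hn : (0 < n)%N.
Hypothesis hkappa : kappa2 <> kappa1 - 1.
Hypothesis hmod : n%:R = kappa2 - kappa1 + 1 :> 'Z_e.
Local Notation cls_ k := (@gap_cls e n k).
Local Notation A := (cyclo_alg F n kappa1 kappa2).
Local Notation E := (@cyclo_e F e n kappa1 kappa2).
Local Notation Y := (@cyclo_y F e n kappa1 kappa2).
Local Notation Psi := (@cyclo_psi F e n kappa1 kappa2).
Local Notation scal := (@cyclo_scal F e n kappa1 kappa2).
Local Notation S m := (specht F n kappa1 kappa2 m).
Local Notation z m := (specht_gen F n kappa1 kappa2 m).
Local Notation mx := 'M[F]_(#|{: fword n}|.-1.+1).
Local Notation vec := 'cV[F]_(#|{: fword n}|.-1.+1).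
Local Notation B := (basis F).
Implicit Types (w : fword n).

Variable rho : {rmorphism A -> mx}.
Hypothesis rho_e : forall i, rho (E i) = wop F n (we kappa2 i).
Hypothesis rho_y : forall r, rho (Y r) = wop F n (wy (cls_ r.+1) r.+1).
Hypothesis rho_psi : forall r, rho (Psi r) = wop F n (wpsi (cls_ r.+1) r.+1).
Hypothesis rho_scal : forall c, rho (scal c) = c%:M.

Lemma rhoM a b (v : vec) : rho (a * b) *m v = rho a *m (rho b *m v).
Proof. by rewrite rmorphM -mulmxE mulmxA. Qed.

Lemma wpsi_supp (r : 'I_n.-1) f : supported n f ->
  supp_res n (wpsi (cls_ r.+1) r.+1 f).
Proof.
move=> sf; apply: wpsi_supported => //; first exact: hi_subproof.
by move/(cls_post hkappa hmod).
Qed.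

Lemma wy_supp (r : 'I_n) f : supported n f -> supp_res n (wy (cls_ r.+1) r.+1 f).
Proof.
move=> sf; apply: wy_supported => //; first exact: ltn_ord.
by move/(cls_post hkappa hmod).
Qed.

Lemma rho_psiE r x : supp_res n x ->
  rho (Psi r) *m wvec bvec x = wvec bvec (wbind x (wpsi (cls_ r.+1) r.+1)).
Proof. by move=> sx; rewrite rho_psi wop_wvec. Qed.

Lemma rho_eE i w : rho (E i) *m B w = if res n kappa2 (ext w) == i then B w else 0.
Proof.
rewrite bvec_ext rho_e wop_bvec; last exact: ext_supported.
by rewrite /we; case: ifP.
Qed.

Lemma ext_lo (r : 'I_n.-1) w : ext w r.+1 = w (lo r).
Proof. exact: (extE w (lo r)). Qed.
Lemma ext_hi (r : 'I_n.-1) w : ext w r.+2 = w (hi r).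
Proof. exact: (extE w (hi r)). Qed.

Lemma bvec_exch (r : 'I_n.-1) w : bvec (exch r.+1 r.+2 (ext w)) = B (swapw r w).
Proof.
rewrite /bvec; congr B; apply/ffunP => k; rewrite !ffunE /exch !eqSS.
case: tpermP => [->|->|/eqP kl /eqP kh]; rewrite ?eqxx ?ext_lo ?ext_hi //.
  by rewrite /= eqn_leq ltnn.
by rewrite -[_ == r :> nat]/(k == lo r) -[_ == r.+1]/(k == hi r) (negPf kl)
  (negPf kh) extE.
Qed.

Lemma rho_psi_basis (r : 'I_n.-1) w :
  rho (Psi r) *m B w = wvec bvec (wpsi (cls_ r.+1) r.+1 (ext w)).
Proof. by rewrite bvec_ext rho_psi wop_bvec //; apply: ext_supported. Qed.

Lemma rho_y_basis (r : 'I_n) w :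
  rho (Y r) *m B w = wvec bvec (wy (cls_ r.+1) r.+1 (ext w)).
Proof. by rewrite bvec_ext rho_y wop_bvec //; apply: ext_supported. Qed.

Lemma rho_psi_LA r w : LAat r w -> rho (Psi r) *m B w = B (swapw r w).
Proof.
by rewrite /LAat -ext_lo -ext_hi rho_psi_basis /wpsi => -> /=; rewrite bvec_exch.
Qed.

Lemma ext_hook m k : (m <= n)%N -> ext (hookw n m) k = (0 < k <= m)%N.
Proof.
case: k => // k mn; have [kn|nk] := ltnP k n.
  by rewrite (extE _ (Ordinal kn)) ffunE.
by rewrite ext_out //=; apply/esym/negbTE; rewrite -leqNgt (leq_trans mn).
Qed.

Lemma res_hook m : (m <= n)%N -> res n kappa2 (ext (hookw n m)) = hook_res n kappa1 kappa2 m.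
Proof.
move=> mn; apply/ffunP => k; rewrite !ffunE /wres ext_hook //=.
have -> : leg_count (ext (hookw n m)) k.+1 = minn k m.
  elim: (nat_of_ord k) => [|j IH]; first by rewrite leg_countS /leg_count big_ord0 min0n.
  by rewrite leg_countS IH ext_hook //=; lia.
case: ltnP => km; first by rewrite subr0.
rewrite natrB // /gap hmod -natr1; ring.
Qed.

(** In L...LA...A no A precedes an L, so the only possible move is LA to AL at the boundary, that
    is, by psi_m. *)
Lemma hook_relations m (a : A) : (m <= n)%N -> specht_rel m a ->
  rho a *m B (hookw n m) = 0.
Proof.
move=> mn; case=> [|r|r rm].
- by rewrite rmorphB rmorph1 mulmxBl mul1mx rho_eE res_hook // eqxx subrr.
- rewrite rho_y_basis /wy; have := @cls_post e n kappa1 kappa2 hkappa hmod r.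
  case: (gap_cls e n r.+1) => // [_|/(_ erefl) r0]; rewrite !ext_hook //=.
    by case: ifP => //; lia.
  by case: ifP => //; lia.
- rewrite rho_psi_basis /wpsi; have := @cls_post e n kappa1 kappa2 hkappa hmod r.
  rewrite !ext_hook //; case: ifP => [|_]; first by lia.
  case: (gap_cls e n r.+1) => // [_|/(_ erefl) r0|_].
  + by case: ifP => //; lia.
  + by case: ifP => //; lia.
  + by case: ifP => //; lia.
Qed.

Lemma specht_genE m (x : S m) : exists a : A, x = a *: z m.
Proof. exact: cyclic_modE. Qed.

Lemma specht_gen_rel m (a : A) : specht_rel m a -> a *: z m = 0.
Proof. exact: cyclic_mod_eq0. Qed.

Lemma theta_exists m : (m <= n)%N ->
  exists th : {additive S m -> vec}, forall a, th (a *: z m) = rho a *m B (hookw n m).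
Proof.
move=> mn; have phi_zmod : zmod_morphism (fun a : A => rho a *m B (hookw n m)).
  by move=> a b; rewrite rmorphB mulmxBl.
pose pz := GRing.isZmodMorphism.Build _ _ _ phi_zmod.
pose phi : {additive A -> vec} :=
  HB.pack_for {additive A -> vec} (fun a : A => rho a *m B (hookw n m)) pz.
apply: (@cyclic_map A (@specht_rel F e n kappa1 kappa2 m) vec phi) => [a b|a] /= H.
  by rewrite rhoM H mulmx0.
exact: hook_relations.
Qed.

Section Theta.
Variables (m : nat) (mn : (m <= n)%N) (th : {additive S m -> vec}).
Hypothesis thE : forall a, th (a *: z m) = rho a *m B (hookw n m).
Local Notation sv := (svec (z m)).

Lemma thZ a x : th (a *: x) = rho a *m th x.
Proof.
have [b xb] := specht_genE x.
have E1 : a *: x = (a * b) *: z m by rewrite xb; apply: scalerA.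
by rewrite E1 (thE (a * b)) xb (thE b) rhoM.
Qed.

(** Each psi in the standard vector turns an LA into AL, which happens without a sign. *)
Lemma th_svec w : legs w = m -> th (sv w) = B w.
Proof.
have [k] := ubnP (pos w); elim: k w => // k IH w wk wm.
case: (pickP (fun r : 'I_n.-1 => ALat r w)) => [r rw|H].
  rewrite (svec_swap _ rw) thZ IH; first 1 last.
  - by rewrite -ltnS -(pos_swapw rw).
  - by rewrite legs_swapw.
  by rewrite rho_psi_LA ?LA_swapw // swapwK.
rewrite svec_hook; last by move=> r; rewrite H.
rewrite (no_AL (fun r => negbT (H r))) wm -[z m]scale1r thE.
by rewrite rmorph1 mul1mx.
Qed.

Definition lcomb (c : fword n -> F) : S m := \sum_(w | legs w == m) scal (c w) *: sv w.

Lemma specht_lcomb (x : S m) : exists c, x = lcomb c.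
Proof.
have [a ->] := specht_genE x.
exact: (svec_span mn (@specht_gen_rel m) a).
Qed.

Lemma th_lcomb c : th (lcomb c) = \sum_(w | legs w == m) c w *: B w.
Proof.
rewrite raddf_sum; apply: eq_bigr => w /eqP wm.
by rewrite thZ th_svec // rho_scal mul_scalar_mx.
Qed.

End Theta.

Definition coef w (v : vec) : F := v (code w) 0.

Lemma coef_basis w u : coef w (B u) = (w == u)%:R.
Proof.
by rewrite /coef mxE eqxx andbT (inj_eq (can_inj (@codeK n))).
Qed.

Lemma coefD w u v : coef w (u + v) = coef w u + coef w v.
Proof. by rewrite /coef mxE. Qed.
Lemma coefZ w c v : coef w (c *: v) = c * coef w v.
Proof. by rewrite /coef mxE. Qed.
Lemma coef0 w : coef w 0 = 0.
Proof. by rewrite /coef mxE. Qed.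

Lemma coef_sum w (P : pred (fword n)) c :
  coef w (\sum_(u | P u) c u *: B u) = if P w then c w else 0.
Proof.
rewrite (big_morph _ (coefD w) (coef0 w)); case: ifP => Pw.
  rewrite (bigD1 w) //= coefZ coef_basis eqxx mulr1 big1 ?addr0 // => u /andP[_ uw].
  by rewrite coefZ coef_basis eq_sym (negPf uw) mulr0.
rewrite big1 // => u Pu; rewrite coefZ coef_basis.
by case: eqP => [wu|_]; [rewrite wu Pu in Pw|rewrite mulr0].
Qed.

Lemma vec_eqP u v : (forall w, coef w u = coef w v) -> u = v.
Proof. by move=> H; apply/colP => i; have := H (decode i); rewrite /coef decodeK. Qed.

Lemma vec_sum v : v = \sum_w coef w v *: B w.
Proof. by apply: vec_eqP => w; rewrite coef_sum. Qed.

Lemma th_coef m (mn : (m <= n)%N) (th : {additive S m -> vec}) :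
    (forall a, th (a *: z m) = rho a *m B (hookw n m)) ->
  forall x w, legs w != m -> coef w (th x) = 0.
Proof.
move=> thE x w wm; have [c ->] := specht_lcomb mn x.
by rewrite th_lcomb // coef_sum (negPf wm).
Qed.

Lemma th_surj m (th : {additive S m -> vec}) v :
    (forall a, th (a *: z m) = rho a *m B (hookw n m)) ->
    (forall w, legs w != m -> coef w v = 0) -> exists x, th x = v.
Proof.
move=> thE vm; exists (lcomb m (coef ^~ v)); rewrite th_lcomb //.
by apply: vec_eqP => w; rewrite coef_sum; case: eqP => // /eqP /vm.
Qed.

(** The standard vectors span, and their images are distinct basis vectors; this gives their
    independence as well. *)
Lemma th_inj m (mn : (m <= n)%N) (th : {additive S m -> vec}) :
  (forall a, th (a *: z m) = rho a *m B (hookw n m)) -> forall x, th x = 0 -> x = 0.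
Proof.
move=> thE x; have [c ->] := specht_lcomb mn x; rewrite th_lcomb // => H.
rewrite /lcomb big1 // => w wm.
have := coef_sum w (fun w => legs w == m) c; rewrite H coef0 wm => <-.
by rewrite cyclo_scal0 scale0r.
Qed.

Lemma gap_n : gap e n n = 0.
Proof. exact: subrr. Qed.

Lemma cls_n : cls_ n = Crit.
Proof. by rewrite /gap_cls gap_n eqxx. Qed.

Lemma cls_pred r : r.+1 = n -> cls_ r = Pre.
Proof.
move=> rn; have := @gap_cls_succ e n he r; rewrite rn cls_n.
by case: (gap_cls e n r).
Qed.

Lemma cls_pred2 r : r.+2 = n -> cls_ r <> Pre.
Proof.
move=> rn E0; have := @gap_cls_succ e n he r; rewrite (cls_pred rn) E0.
by [].
Qed.

(** For r < n - 1 the move avoids letter n, as n - 2 is not [Pre]. At r = n - 1 only LA to AL can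
    occur, since letter n + 1 is A, and both composites vanish. *)
Lemma wgam_psi r f : (0 < r < n)%N -> supported n f ->
  wbind (wgam n f) (wpsi (cls_ r) r) = wbind (wpsi (cls_ r) r f) (wgam n).
Proof.
move=> /andP[r0 rn] sf; move: (rn); rewrite leq_eqVlt => /orP[/eqP rn1|rn1]; last first.
  apply/esym; apply: (@wbind_disjoint n).
    move=> h g; apply: wpsi_lo => // E0; have := rn1; rewrite leq_eqVlt => /orP[/eqP rn2|//].
    by case: (cls_pred2 rn2).
  by move=> h g; apply: wgam_hi.
rewrite (cls_pred rn1) /wpsi /wgam rn1.
have fn1 : f n.+1 = false by apply/negbTE/negP => /(supported_le sf); rewrite ltnn.
have ln : set_last n f n = true by rewrite /set_last eqxx.
have ln1 : set_last n f n.+1 = false by rewrite /set_last gtn_eqF.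
rewrite fn1 !andbF; case fn: (f n); rewrite /= ?ln ?ln1 ?andbF ?andbT //=.
by case fr: (f r) => //=; rewrite /exch (gtn_eqF rn) eqxx fr.
Qed.

Lemma wgam_y r f : (0 < r <= n)%N -> supported n f ->
  wbind (wgam n f) (wy (cls_ r) r) = wbind (wy (cls_ r) r f) (wgam n).
Proof.
move=> /andP[r0 rn] sf; have fn1 : f n.+1 = false.
  by apply/negbTE/negP => /(supported_le sf); rewrite ltnn.
move: (rn); rewrite leq_eqVlt => /orP[/eqP->|rn'].
  rewrite cls_n /wy /wgam fn1 andbF; case: (f n) => //=.
  by rewrite /set_last eqxx.
apply/esym; apply: (@wbind_disjoint n).
  move=> h g; apply: wy_lo => // E0; have := rn'; rewrite leq_eqVlt => /orP[/eqP rn1|//].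
  by rewrite (cls_pred rn1) in E0.
by move=> h g; apply: wgam_hi.
Qed.

(** The gap at n is 0, and letter n counts for no earlier residue. *)
Lemma res_set_last f : ~~ f n -> res n kappa2 (set_last n f) = res n kappa2 f.
Proof.
move=> fn; apply/ffunP => k; rewrite !ffunE /wres.
have -> : leg_count (set_last n f) k.+1 = leg_count f k.+1.
  apply: eq_bigr => j _; rewrite /set_last ltn_eqF //.
  exact: leq_trans (ltn_ord j) (ltn_ord k).
rewrite /set_last; case: eqP => // ->.
by rewrite (negPf fn) gap_n.
Qed.

Definition Gam : mx := wop F n (wgam n).

Lemma wgam_supp f : supported n f -> supp_res n (wgam n f).
Proof.
move=> [f0 fn]; rewrite /wgam; case: ifP => //= _; rewrite /set_last; split.
  by rewrite ltn_eqF.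
by move=> k nk; rewrite gtn_eqF // fn.
Qed.

Let mulmxA2 (M N : mx) (v : vec) : (M * N) *m v = M *m (N *m v).
Proof. by rewrite -mulmxE mulmxA. Qed.

Lemma Gam_comm a : rho a * Gam = Gam * rho a.
Proof.
move: a; apply: cyclo_alg_ind => [c|a b Ha Hb|a b Ha Hb|i|r|r].
- by rewrite rho_scal; apply: comm_scalar_mx.
- by rewrite rmorphD mulrDl mulrDr Ha Hb.
- by rewrite rmorphM -[LHS]mulrA Hb [LHS]mulrA Ha -[LHS]mulrA.
- apply: wop_eqP => f sf; rewrite rho_e 2!mulmxA2 2?wop_bvec //.
  rewrite 2?wop_wvec //; try exact: wgam_supp; last first.
    by rewrite /we; case: ifP.
  congr wvec; rewrite /we /wgam; case: (boolP (f n)) => fn /=.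
    by case: ifP => //= _; rewrite fn.
  by rewrite res_set_last //; case: ifP => //= _; rewrite (negPf fn).
- apply: wop_eqP => f sf; rewrite rho_y 2!mulmxA2 2?wop_bvec //.
  rewrite 2?wop_wvec //; try exact: wgam_supp; last exact: wy_supp.
  by rewrite wgam_y // ltn_ord.
- apply: wop_eqP => f sf; rewrite rho_psi 2!mulmxA2 2?wop_bvec //.
  rewrite 2?wop_wvec //; try exact: wgam_supp; last exact: wpsi_supp.
  by rewrite wgam_psi //; apply: hi_subproof.
Qed.

Local Notation G := Gam.
Local Notation spec m th := (forall a : A, th (a *: z m) = rho a *m B (hookw n m)).

Fact lastp_subproof : (n.-1 < n)%N.
Proof. by rewrite ltn_predL. Qed.
Definition lastp : 'I_n := Ordinal lastp_subproof.
Definition setL w : fword n := [ffun k => (k == lastp) || w k].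
Definition clearL w : fword n := [ffun k => (k != lastp) && w k].

Lemma lastpE (k : 'I_n) : (k == lastp) = (k.+1 == n).
Proof. by rewrite -val_eqE /= -eqSS prednK. Qed.

Lemma ext_last w : ext w n = w lastp.
Proof. by rewrite -(extE w lastp); congr (ext w _); rewrite /= prednK. Qed.

Lemma setL_last w : setL w lastp.
Proof. by rewrite ffunE eqxx. Qed.
Lemma clearL_last w : ~~ clearL w lastp.
Proof. by rewrite ffunE eqxx. Qed.
Lemma setLK w : ~~ w lastp -> clearL (setL w) = w.
Proof.
by move=> wl; apply/ffunP => k; rewrite !ffunE; case: eqP => // ->; rewrite (negPf wl).
Qed.
Lemma clearLK w : w lastp -> setL (clearL w) = w.
Proof. by move=> wl; apply/ffunP => k; rewrite !ffunE; case: eqP => // ->. Qed.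

Lemma legs_clearL w : w lastp -> legs w = (legs (clearL w)).+1.
Proof.
move=> wl; rewrite /legs (bigD1 lastp) // [in RHS](bigD1 lastp) //= wl.
rewrite (negPf (clearL_last w)) add0n add1n; congr _.+1; apply: eq_bigr => k kl.
by rewrite ffunE kl.
Qed.
Lemma legs_setL w : ~~ w lastp -> legs (setL w) = (legs w).+1.
Proof. by move=> wl; rewrite legs_clearL ?setL_last // setLK. Qed.

Lemma Gam_basis w : G *m B w = if w lastp then 0 else B (setL w).
Proof.
rewrite bvec_ext wop_bvec; last exact: ext_supported.
rewrite /wgam ext_last; case: ifP => //= _; congr B; apply/ffunP => k.
by rewrite !ffunE /set_last lastpE extE; case: ifP.
Qed.

Lemma coef_Gam w v : coef w (G *m v) = if w lastp then coef (clearL w) v else 0.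
Proof.
rewrite {1}(vec_sum v) mulmx_sumr (big_morph _ (coefD w) (coef0 w)).
case: (boolP (w lastp)) => wl.
  rewrite (bigD1 (clearL w)) //= -scalemxAr Gam_basis (negPf (clearL_last w)).
  rewrite clearLK // coefZ coef_basis eqxx mulr1 big1 ?addr0 // => u uw.
  rewrite -scalemxAr Gam_basis coefZ; case: ifP => [_|/negbT ul].
    by rewrite coef0 mulr0.
  rewrite coef_basis; case: eqP => [E0|]; last by rewrite mulr0.
  by rewrite E0 setLK // eqxx in uw.
rewrite big1 // => u _; rewrite -scalemxAr Gam_basis coefZ.
case: ifP => _; first by rewrite coef0 mulr0.
rewrite coef_basis; case: eqP => [E0|]; last by rewrite mulr0.
by rewrite E0 setL_last in wl.
Qed.

Definition ends_leg (v : vec) := forall w, ~~ w lastp -> coef w v = 0.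

Lemma Gam_eq0 v : G *m v = 0 <-> ends_leg v.
Proof.
split=> [H w wl|H].
  by have := coef_Gam (setL w) v; rewrite H coef0 setL_last setLK.
by apply: vec_eqP => w; rewrite coef_Gam coef0; case: ifP => // _; apply/H/clearL_last.
Qed.

Lemma ends_leg_Gam v : ends_leg (G *m v).
Proof. by move=> w wl; rewrite coef_Gam (negPf wl). Qed.

Lemma Gam_surj k v : ends_leg v -> (forall w, legs w != k.+1 -> coef w v = 0) ->
  exists2 u, G *m u = v & forall w, legs w != k -> coef w u = 0.
Proof.
move=> vl vk; exists (\sum_(w : fword n | ~~ w lastp) coef (setL w) v *: B w).
  apply: vec_eqP => w; rewrite coef_Gam coef_sum; case: ifP => wl.
    by rewrite clearL_last clearLK.
  by rewrite vl ?wl.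
move=> w wk; rewrite coef_sum; case: ifP => // wl.
by apply: vk; rewrite legs_setL // eqSS.
Qed.

Lemma GamC a (v : vec) : rho a *m (G *m v) = G *m (rho a *m v).
Proof.
rewrite !mulmxA; congr (_ *m v).
exact: Gam_comm.
Qed.

Section Gamma.
Variable k : nat.
Hypothesis kn : (k < n)%N.
Variables (th : {additive S k -> vec}) (th' : {additive S k.+1 -> vec}).
Hypotheses (thE : spec k th) (thE' : spec k.+1 th').

Let moveL t d : (t + d <= n.-1)%N -> (k <= t)%N ->
    forall l : seq 'I_n.-1, map val l = iota t d ->
  rho (\prod_(r <- rev l) Psi r) *m B [ffun i : 'I_n => (i < k)%N || (i == t :> nat)] =
  B [ffun i : 'I_n => (i < k)%N || (i == (t + d)%N :> nat)].
Proof.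
elim: d t => [|d IH] t td kt [|r l] //=.
  by move=> _; rewrite addn0 /rev /= big_nil rmorph1 mul1mx.
case=> E0 El.
rewrite rev_cons -cats1 big_cat big_seq1 rhoM.
set w := [ffun i : 'I_n => (i < k)%N || (i == t :> nat)] : fword n.
have LA : LAat r w by rewrite /LAat !ffunE /= E0; lia.
rewrite (rho_psi_LA LA).
have -> : swapw r w = [ffun i : 'I_n => (i < k)%N || (i == t.+1 :> nat)].
  apply/ffunP => i; have [->|il] := eqVneq i (lo r).
    by rewrite swapw_lo !ffunE /= E0; lia.
  have [->|ih] := eqVneq i (hi r); first by rewrite swapw_hi !ffunE /= E0; lia.
  rewrite swapw_out // !ffunE; congr (_ || _).
  by move: il ih; rewrite -!val_eqE /= E0 => /negPf-> /negPf->.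
by rewrite (IH t.+1) ?addSnnS // ltnW.
Qed.

Lemma th_hook_v : th' (hook_v F n kappa1 kappa2 k) = G *m B (hookw n k).
Proof.
(* In v(1, ..., k, n) the first k factors are empty; the last one moves a leg from position k + 1 to
   n across arms. *)
rewrite /hook_v /specht_v (thE' _) big_ord_recr /= big1 ?mul1r; last first.
  move=> j _; rewrite ltn_ord big_pred0 // => r.
  by rewrite leqNgt andNb.
rewrite ltnn -big_filter.
have -> : [seq r : 'I_n.-1 <- rev (enum 'I_n.-1) | (k <= r < n.-1)%N] =
          rev [seq r : 'I_n.-1 <- enum 'I_n.-1 | (k <= r)%N].
  by rewrite filter_rev; congr rev; apply: eq_filter => r; rewrite ltn_ord andbT.
have -> : hookw n k.+1 = [ffun i : 'I_n => (i < k)%N || (i == k :> nat)].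
  by apply/ffunP => i; rewrite !ffunE ltnS leq_eqVlt orbC.
have kn' : (k <= n.-1)%N by rewrite -ltnS prednK.
rewrite (@moveL k (n.-1 - k)) ?subnKC //; last first.
  rewrite -filter_map -[X in filter _ X]/(map val (enum 'I_n.-1)) val_enum_ord.
  rewrite -{1}(subnKC kn') iotaD filter_cat add0n.
  rewrite (eq_in_filter (a2 := pred0)) ?filter_pred0; last first.
    by move=> j; rewrite mem_iota add0n /= => jk; rewrite leqNgt jk.
  by apply/all_filterP/allP => j; rewrite mem_iota => /andP[].
rewrite Gam_basis ffunE /= ltnNge kn' /=; congr B; apply/ffunP => i.
by rewrite !ffunE orbC.
Qed.

(** The relations of the generator are checked after the injective map [th'], where they follow
    because [Gam] commutes with the action. So [gamma] is not the default zero map. *)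
Lemma gamma_exists : exists f : {linear S k -> S k.+1},
  f (z k) = hook_v F n kappa1 kappa2 k.
Proof.
apply: (@cyclic_lift A (@specht_rel F e n kappa1 kappa2 k) (S k.+1)) => a ka.
apply: (th_inj kn thE').
rewrite (thZ thE') th_hook_v.
rewrite GamC; have -> : rho a *m B (hookw n k) = 0; last by rewrite mulmx0.
by apply: hook_relations => //; apply: ltnW.
Qed.

Lemma gammaE : gamma F n kappa1 kappa2 k (z k) = hook_v F n kappa1 kappa2 k.
Proof.
rewrite /gamma; case: pselect => [H|[]]; last exact: gamma_exists.
exact: (projT2 (cid H)).
Qed.

Lemma th_gamma x : th' (gamma F n kappa1 kappa2 k x) = G *m th x.
Proof.
have [a xa] := specht_genE x.
rewrite xa [gamma _ _ _ _ _ _]linearZ.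
by rewrite (thZ thE') gammaE th_hook_v (thE a) GamC.
Qed.

End Gamma.

(** * Sorting and separating words that end in L *)

Local Notation last := lastp.

Let psiE := rho_psi_basis.
Let yE := rho_y_basis.
Let psiE2 (r : 'I_n.-1) s (f : word) : supported n f -> rho (Psi r) *m wvec bvec (Some (s, f)) =
  wvec bvec (if wpsi (cls_ r.+1) r.+1 f is Some (s', f') then Some (s (+) s', f') else None).
Proof. by move=> sf; apply: rho_psiE. Qed.

Ltac exch_tac E0 E1 E2 := apply: funext => k; rewrite /exch;
  do ![case: eqP => ?]; subst; rewrite ?E0 ?E1 ?E2 //; lia.

(** Each class of the position has its own operator. At [Pre] and [Post] a third letter is involved
    and two psi are needed; the sign of the three-letter move is compensated. *)
Lemma lower_AL r w : ALat r w -> (r.+1 < n.-1)%N ->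
  exists a, rho a *m B w = B (swapw r w).
Proof.
move=> /andP[]; rewrite -ext_lo -ext_hi -bvec_exch => /negPf fr fr1 rn.
have sf := ext_supported w.
have sp (q : 'I_n.-1) s g : wpsi (cls_ q.+1) q.+1 (ext w) = Some (s, g) -> supported n g.
  by move=> E0; have := wpsi_supp q sf; rewrite E0.
have hc := @gap_cls_succ e n he r.+1.
have pE q := psiE q w; have yEw q := yE q w.
move: (ext w) sf sp fr fr1 pE yEw => f sf sp fr fr1 pE yEw.
case Ec: (gap_cls e n r.+1) hc => hc.
- have E1 : wy (cls_ r.+2) r.+2 f = Some (false, exch r.+1 r.+2 f).
    by case: (gap_cls e n r.+2) hc => //= _; rewrite fr fr1.
  by exists (Y (hi r)); rewrite yEw [wy _ _ _]E1.
- pose q := Ordinal rn; have Ec' : gap_cls e n r.+2 = Crit.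
    by case: (gap_cls e n r.+2) hc.
  (* The letters at [r.+1], [r.+2], [r.+3] go through ALL, LLA, LAL if the third is L, and through
     ALA, AAL, LAA otherwise. *)
  case f2: (f r.+3).
    have E1 : wpsi (cls_ r.+1) r.+1 f = Some (false, exch r.+1 r.+3 f).
      by rewrite /wpsi Ec fr f2 fr1.
    exists (Psi q * Psi r); rewrite rhoM pE E1 psiE2; last exact: sp E1.
    have -> : wpsi (cls_ q.+1) q.+1 (exch r.+1 r.+3 f) =
        Some (false, exch r.+2 r.+3 (exch r.+1 r.+3 f)).
      by rewrite /wpsi /= exchR (exchD f) ?fr ?fr1 //; lia.
    rewrite /=; congr bvec.
    by exch_tac fr fr1 f2.
  have E1 : wpsi (cls_ q.+1) q.+1 f = Some (false, exch r.+2 r.+3 f).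
    by rewrite /wpsi /= fr1 f2.
  exists (- (Psi r * Psi q)); rewrite rmorphN mulNmx rhoM pE E1 psiE2; last exact: sp E1.
  have -> : wpsi (cls_ r.+1) r.+1 (exch r.+2 r.+3 f) =
      Some (true, exch r.+1 r.+3 (exch r.+2 r.+3 f)).
    rewrite /wpsi Ec exchR exchL (exchD f) ?fr ?fr1 ?f2 //; lia.
  rewrite /= opprK; congr bvec.
  by exch_tac fr fr1 f2.
- have r0 : (0 < r)%N by apply: (cls_post hkappa hmod).
  have qn : (r.-1 < n.-1)%N by rewrite (leq_ltn_trans (leq_pred r)).
  pose q := Ordinal qn; have qr : q.+1 = r :> nat by rewrite /= prednK.
  (* The letters at [r], [r.+1], [r.+2] go through LAL, ALL, LLA if the first is L, and through AAL,
     LAA, ALA otherwise. *)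
  case f2: (f r).
    have E1 : wpsi (cls_ q.+1) q.+1 f = Some (false, exch r r.+1 f).
      by rewrite /wpsi qr fr f2.
    exists (Psi r * Psi q); rewrite rhoM pE E1 psiE2; last exact: sp E1.
    have -> : wpsi (cls_ r.+1) r.+1 (exch r r.+1 f) =
        Some (false, exch r r.+2 (exch r r.+1 f)).
      by rewrite /wpsi Ec /= exchR exchL (exchD f) ?fr ?fr1 ?f2 //; lia.
    rewrite /=; congr bvec.
    by exch_tac fr fr1 f2.
  have E1 : wpsi (cls_ r.+1) r.+1 f = Some (true, exch r r.+2 f).
    by rewrite /wpsi Ec fr fr1 /= f2.
  exists (- (Psi q * Psi r)); rewrite rmorphN mulNmx rhoM pE E1 psiE2; last exact: sp E1.
  have -> : wpsi (cls_ q.+1) q.+1 (exch r r.+2 f) =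
      Some (false, exch r r.+1 (exch r r.+2 f)).
    rewrite /wpsi qr exchL (exchD f) ?fr ?fr1 ?f2 //; lia.
  rewrite /= opprK; congr bvec.
  by exch_tac fr fr1 f2.
- have E1 : wpsi (cls_ r.+1) r.+1 f = Some (false, exch r.+1 r.+2 f).
    by rewrite /wpsi Ec fr fr1.
  by exists (Psi r); rewrite pE E1.
Qed.

Lemma psi_crit (r : 'I_n.-1) u : cls_ r.+1 = Crit ->
  rho (Psi r) *m B u = if LAat r u then B (swapw r u) else 0.
Proof.
move=> Ec; case: ifP => [|LA]; first exact: rho_psi_LA.
by rewrite psiE /wpsi Ec ext_lo ext_hi -/(LAat r u) LA.
Qed.

Lemma y_crit (r : 'I_n.-1) u : cls_ r.+1 = Crit ->
  rho (Y (hi r)) *m B u = if ALat r u then B (swapw r u) else 0.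
Proof.
move=> Ec; have := @gap_cls_succ e n he r.+1; rewrite Ec => Ep; rewrite yE.
have -> : wy (cls_ (hi r).+1) (hi r).+1 (ext u) =
    if ALat r u then Some (false, exch r.+1 r.+2 (ext u)) else None.
  rewrite /ALat -ext_lo -ext_hi -[gap_cls e n (hi r).+1]/(gap_cls e n r.+2).
  by case: (gap_cls e n r.+2) Ep.
by case: ifP => // _; rewrite -bvec_exch.
Qed.

(** At a critical position psi and y exchange LA and AL inversely and kill all other words, so both
    products are projections. *)
Lemma proj_LA (r : 'I_n.-1) u : cls_ r.+1 = Crit ->
  rho (Y (hi r) * Psi r) *m B u = if LAat r u then B u else 0.
Proof.
move=> Ec; rewrite rhoM psi_crit //; case: ifP => LA; last by rewrite mulmx0.
by rewrite y_crit // AL_swapw LA swapwK.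
Qed.

Lemma proj_AL (r : 'I_n.-1) u : cls_ r.+1 = Crit ->
  rho (Psi r * Y (hi r)) *m B u = if ALat r u then B u else 0.
Proof.
move=> Ec; rewrite rhoM y_crit //; case: ifP => AL; last by rewrite mulmx0.
by rewrite psi_crit // LA_swapw AL swapwK.
Qed.

(** Words with different residue sequences are separated by some e(i). Otherwise the first
    difference is at a critical position, where one word has LA and the other AL. *)
Lemma separate w1 w2 : w1 last -> w2 last -> w1 != w2 ->
  exists (a : A) (p : pred (fword n)),
    [/\ forall u, rho a *m B u = if p u then B u else 0, p w1 & ~~ p w2].
Proof.
move=> l1 l2 ne; case: (res n kappa2 (ext w2) =P res n kappa2 (ext w1)) => [eres|/eqP nres].
  have ne_letter : exists j, ext w1 j.+1 != ext w2 j.+1.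
    have /existsP[j wj] : [exists j, w1 j != w2 j].
      apply: contraR ne; rewrite negb_exists => /forallP H.
      by apply/eqP/ffunP => j; apply/eqP; rewrite -[_ == _]negbK H.
    by exists j; rewrite !extE.
  case: (ex_minnP ne_letter) => j wj jmin.
  have jn : (j < n)%N.
    rewrite ltnNge; apply/negP => nj; move: wj.
    by rewrite !ext_out ?eqxx.
  (* The last letters agree, so the first difference lies before position n. *)
  have jl : (j < n.-1)%N.
    have : j != n.-1.
      apply: contraNneq wj => ->; rewrite prednK // !ext_last.
      by rewrite l1 l2.
    by move: jn; lia.
  pose r := Ordinal jl.
  have cnt : leg_count (ext w1) j.+1 = leg_count (ext w2) j.+1.
    apply: eq_bigr => i _; congr nat_of_bool; case: (nat_of_ord i) (ltn_ord i) => [|i'] // ij.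
    by apply/eqP; apply: contraTT ij => /jmin; rewrite -leqNgt.
  have resE i : (i < n)%N -> wres n kappa2 (ext w2) i.+1 = wres n kappa2 (ext w1) i.+1.
    by move=> ni; move/ffunP/(_ (Ordinal ni)): eres; rewrite !ffunE.
  (* With equal leg counts before it, the residues there differ by the gap up to sign. *)
  have g0 : gap e n j.+1 = 0.
    have := resE j jn; rewrite /wres cnt.
    case: (ext w1 j.+1) (ext w2 j.+1) wj => [] [] // _ /addrI/eqP;
      by rewrite eqr_opp => /eqP.
  have Ec : cls_ r.+1 = Crit by rewrite /gap_cls g0 eqxx.
  have h1 := @one_neq0 e; have h2 := two_neq0 he.
  (* At gap 0 the residue changes by -1 after LL, by 0 after LA or AL, and by 1 after AA. These
     values being distinct, the next residues agree only for LA against AL. *)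
  have := resE j.+1; rewrite -ltn_predRL => /(_ jl).
  rewrite [X in X = _]wresS [X in _ = X]wresS (resE j jn) => /addrI; rewrite g0 oppr0.
  have eLA u : LAat r u = ext u j.+1 && ~~ ext u j.+2.
    by rewrite /LAat -ext_lo -ext_hi.
  have eAL u : ALat r u = ~~ ext u j.+1 && ext u j.+2.
    by rewrite /ALat -ext_lo -ext_hi.
  case E1: (ext w1 j.+1) wj => wj.
    have {}wj : ext w2 j.+1 = false by case: (ext w2 j.+1) wj.
    rewrite wj => E2; exists (Y (hi r) * Psi r), (LAat r); split.
    + by move=> u; apply: proj_LA.
    + rewrite eLA E1; case: (ext w1 j.+2) E2 => //.
      case: (ext w2 j.+2) => /eqP; first by rewrite eq_sym oppr_eq0 (negPf h1).
      by rewrite -subr_eq0 opprK (negPf h2).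
    + by rewrite eLA wj.
  have {}wj : ext w2 j.+1 by case: (ext w2 j.+1) wj.
  rewrite wj => E2; exists (Psi r * Y (hi r)), (ALat r); split.
  + by move=> u; apply: proj_AL.
  + rewrite eAL E1; case: (ext w1 j.+2) E2 => //.
    case: (ext w2 j.+2) => /eqP; last by rewrite eq_sym (negPf h1).
    by rewrite eq_sym -subr_eq0 opprK (negPf h2).
  + by rewrite eAL wj.
exists (E (res n kappa2 (ext w1))), (fun u => res n kappa2 (ext u) == res n kappa2 (ext w1)).
by split=> // u; rewrite rho_eE.
Qed.

Section Simple.
Variable k : nat.
Hypothesis kn : (k < n)%N.
Variable th : {additive S k.+1 -> vec}.
Hypothesis thE : spec k.+1 th.
Variable U : submodule (S k.+1).

Let thZ a x : th (a *: x) = rho a *m th x. Proof. exact: thZ. Qed.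

Definition vsupp (v : vec) : {set fword n} := [set w | coef w v != 0].

Lemma coef_proj (a : A) (p : pred (fword n)) w v :
    (forall u, rho a *m B u = if p u then B u else 0) ->
  coef w (rho a *m v) = if p w then coef w v else 0.
Proof.
move=> H; rewrite {1}(vec_sum v) mulmx_sumr -(coef_sum w p (fun u => coef u v)).
congr (coef w _); rewrite [RHS]big_mkcond; apply: eq_bigr => u _.
by rewrite -scalemxAr H; case: ifP => // _; rewrite scaler0.
Qed.

(** As long as two words occur in x, a separating projection keeps one and removes the other, so the
    support shrinks to one word, whose coefficient is then inverted. *)
Lemma isolate x : x \in U -> th x != 0 -> ends_leg (th x) ->
  exists w x', [/\ x' \in U, th x' = B w, w last & legs w = k.+1].
Proof.
have [N] := ubnP #|vsupp (th x)|; elim: N x => // N IH x xN Ux x0 xl.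
have supp_last w : coef w (th x) != 0 -> w last.
  by apply: contraNT => /xl ->.
have [w1 w1x] : exists w, coef w (th x) != 0.
  apply/existsP; apply: contraR x0; rewrite negb_exists => /forallP H.
  apply/eqP/vec_eqP => w; rewrite coef0; apply/eqP.
  by rewrite -[_ == _]negbK H.
have w1l := supp_last _ w1x.
have [/existsP[w2 /andP[w2x w21]]|] := boolP [exists w2, (coef w2 (th x) != 0) && (w1 != w2)].
  have [a [p [ap p1 p2]]] := separate w1l (supp_last _ w2x) w21.
  have cax w : coef w (th (a *: x)) = if p w then coef w (th x) else 0.
    by rewrite thZ (coef_proj _ _ ap).
  apply: (IH (a *: x)).
  - rewrite -ltnS; apply: leq_trans xN; rewrite ltnS; apply: proper_card; apply/properP; split.
      by apply/subsetP => w; rewrite !inE cax; case: ifP => // _; rewrite eqxx.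
    by exists w2; rewrite inE // cax (negPf p2) eqxx.
  - exact: rpredZ.
  - apply: contraNneq w1x => H; have := cax w1; rewrite H coef0 p1.
    by move=> E0; rewrite -E0.
  - by move=> w wl; rewrite cax xl //; case: ifP.
rewrite negb_exists => /forallP H.
have thx : th x = coef w1 (th x) *: B w1.
  apply: vec_eqP => w; rewrite coefZ coef_basis; have := H w.
  rewrite negb_and negbK; have [->|w1w] := eqVneq w1 w; first by rewrite mulr1.
  by rewrite orbF mulr0 => /eqP.
exists w1, (scal (coef w1 (th x))^-1 *: x); split=> //; first exact: rpredZ.
  by rewrite thZ rho_scal mul_scalar_mx {2}thx scalerA mulVf // scale1r.
apply/eqP; apply: contraNT w1x => wk.
by rewrite (th_coef kn thE).
Qed.

Lemma descend w x : x \in U -> th x = B w -> w last -> legs w = k.+1 ->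
  exists2 x', x' \in U & th x' = G *m B (hookw n k).
Proof.
have [N] := ubnP (pos w); elim: N w x => // N IH w x wN Ux xw wl wk.
case: (pickP (fun r : 'I_n.-1 => ALat r w && (r.+1 < n.-1)%N)) => [r /andP[rw rn]|H].
  have [a aw] := lower_AL rw rn.
  apply: (IH (swapw r w) (a *: x)).
  - by rewrite -ltnS -(pos_swapw rw).
  - exact: rpredZ.
  - by rewrite thZ xw.
  - by rewrite swapw_out // -val_eqE /=; lia.
  - by rewrite legs_swapw.
exists x => //; rewrite xw Gam_basis.
(* An AL in [clearL w] would be an AL of w away from the last letter, and there is none left. *)
have wE : clearL w = hookw n k.
  have -> : k = legs (clearL w) by apply: succn_inj; rewrite -legs_clearL.
  apply: no_AL => r; apply/negP => /andP[]; rewrite !ffunE => Hl /andP[hl wh].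
  have rn : (r.+1 < n.-1)%N.
    by move: hl; rewrite -val_eqE /=; have := ltn_ord r; lia.
  have := H r; rewrite rn andbT /ALat wh andbT => /negbT; rewrite negbK => wlo.
  by move: Hl; rewrite wlo andbT negbK -val_eqE /=; lia.
by rewrite -wE (negPf (clearL_last w)) clearLK.
Qed.

(** A nonzero submodule of the span of the words ending in L thus contains L...LA...AL, which
    generates the image of gamma. *)
Lemma simple_core x : x \in U -> x != 0 -> ends_leg (th x) ->
  hook_v F n kappa1 kappa2 k \in U.
Proof.
move=> Ux x0 xl; have inj y : th y = 0 -> y = 0 by apply: (th_inj kn thE).
have thx0 : th x != 0 by apply: contraNneq x0 => /inj ->.
have [w [x' [Ux' x'w wl wk]]] := isolate Ux thx0 xl.
have [x'' Ux'' x''E] := descend Ux' x'w wl wk.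
have -> : hook_v F n kappa1 kappa2 k = x'' => //.
apply/eqP; rewrite -subr_eq0; apply/eqP/inj; rewrite raddfB x''E.
by rewrite (th_hook_v kn thE) subrr.
Qed.

End Simple.

(** * Kernel and image of gamma *)

Section Exactness.
Variable k : nat.
Hypothesis kn : (k < n)%N.
Variables (th : {additive S k -> vec}) (th' : {additive S k.+1 -> vec}).
Hypotheses (thE : spec k th) (thE' : spec k.+1 th').
Local Notation gam := (gamma F n kappa1 kappa2 k).

Let gamE x : th' (gam x) = G *m th x.
Proof. exact: (th_gamma kn thE thE'). Qed.

Lemma im_gammaP x : x \in im_submod gam <-> ends_leg (th' x).
Proof.
rewrite inE; split=> [/asboolP[y <-]|xl]; first by rewrite gamE; apply: ends_leg_Gam.
have xk w : legs w != k.+1 -> coef w (th' x) = 0.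
  exact: (th_coef kn thE').
have [u Gu uk] := Gam_surj xl xk.
have [y yu] := th_surj thE uk.
apply/asboolP; exists y; apply/eqP; rewrite -subr_eq0; apply/eqP.
apply: (th_inj kn thE').
by rewrite raddfB gamE yu Gu subrr.
Qed.

Lemma gamma_eq0 x : gam x = 0 <-> ends_leg (th x).
Proof.
rewrite -Gam_eq0 -gamE; split=> [->|]; first by rewrite raddf0.
exact: (th_inj kn thE').
Qed.

Let gam_gen a : gam (a *: z k) = a *: hook_v F n kappa1 kappa2 k.
Proof.
rewrite [LHS]linearZ; congr (_ *: _).
exact: (gammaE kn thE').
Qed.

Lemma im_gamma_sub (W : submodule (S k.+1)) :
  hook_v F n kappa1 kappa2 k \in W -> {subset im_submod gam <= W}.
Proof.
move=> hW y; rewrite inE => /asboolP[x <-]; have [a ->] := specht_genE x.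
by rewrite gam_gen rpredZ.
Qed.

Lemma hook_v_neq0 : hook_v F n kappa1 kappa2 k != 0.
Proof.
apply: contraTneq isT => H; have := th_hook_v kn thE'.
have kl : (n.-1 < k)%N = false by move: kn hn; lia.
rewrite H raddf0 Gam_basis ffunE /= kl.
move/(congr1 (coef (setL (hookw n k)))); rewrite coef0 coef_basis eqxx.
by move/eqP; rewrite eq_sym oner_eq0.
Qed.

End Exactness.

End HookModule.

(** * Simple factors and the first isomorphism theorem *)

Section Modules.
Variables (R : pzRingType) (V : lmodType R).

Lemma simple_factorP (T U : submodule V) :
    {subset U <= T} -> (exists2 x, x \in T & x \notin U) ->
    (forall (W : submodule V) x, {subset U <= W} -> x \in W -> x \in T ->
       x \notin U -> {subset T <= W}) ->
  simple_factor T U.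
Proof.
move=> UT [x Tx Ux] H; pose pi (t : submod_type T) : quot_mod (trace_submod T U) := (\pi t)%qT.
have piE t t' : pi t = pi t' <-> val t - val t' \in U by exact: quot_modP.
have pi_lin a t t' : pi (a *: t + t') = a *: pi t + pi t'.
  rewrite /pi pi_quotD; congr (_ + _); exact/esym/pi_quotZ.
have pi00 : pi 0 = 0 by apply: (addrI (pi 0)); rewrite -[LHS]pi_quotD !addr0.
have pi0 t : pi t = 0 <-> val t \in U by rewrite -pi00 piE subr0.
split.
  exists (pi (Sub x Tx)); apply: contraNneq Ux => /pi0.
  by rewrite SubK.
move=> Q; case: (pselect (Q =i zero_submod _)) => [|nQ]; [by left|right].
(* A submodule [Q] of the quotient is replaced by its preimage in T, which contains U. *)
have W_closed : GRing.submod_closed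
    [pred v : V | `[< exists t : submod_type T, val t = v /\ pi t \in Q >]].
  split=> [|a u v]; rewrite !inE.
    by apply/asboolP; exists 0; rewrite pi00 rpred0.
  move=> /asboolP[t [<- Qt]] /asboolP[t' [<- Qt']]; apply/asboolP.
  by exists (a *: t + t'); rewrite linearP pi_lin rpredD ?rpredZ.
pose W := Submodule W_closed.
have [q Qq q0] : exists2 q, q \in Q & q != 0.
  apply: contrapT => nex; apply: nQ => q; rewrite [RHS]inE.
  apply/idP/eqP => [Qq|->]; last exact: rpred0.
  by apply: contrapT => /eqP q0; apply: nex; exists q.
have qE : pi (repr q) = q by apply: reprK.
have TW : {subset T <= W}.
  apply: (H W (val (repr q))).
  - move=> u Uu; rewrite inE; apply/asboolP; exists (Sub u (UT u Uu)).
    by rewrite SubK; split=> //; rewrite (iffRL (pi0 _)) ?rpred0 ?SubK.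
  - by rewrite inE; apply/asboolP; exists (repr q); rewrite qE.
  - exact: valP.
  - by apply: contraNN q0 => /pi0; rewrite qE => ->.
move=> p; rewrite [RHS]inE; have pE : pi (repr p) = p by apply: reprK.
have := TW _ (valP (repr p)); rewrite inE => /asboolP[t [/val_inj ->]].
by rewrite pE.
Qed.

Lemma first_isomorphism (W : lmodType R) (f : {linear V -> W}) (K : submodule V) :
    (forall x, x \in K <-> f x = 0) ->
  exists g : {linear quot_mod K -> submod_type (im_submod f)}, bijective g.
Proof.
move=> kerf; have fim x : f x \in im_submod f by rewrite inE; apply/asboolP; exists x.
pose pi x : quot_mod K := (\pi x)%qT.
have reprE q : pi (repr q) = q by apply: reprK.
have fE x y : pi x = pi y <-> f x = f y.
  rewrite /pi quot_modP kerf linearB; split=> [/eqP|E]; first by rewrite subr_eq0 => /eqP.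
  by apply/eqP; rewrite subr_eq0; apply/eqP.
pose g (q : quot_mod K) : submod_type (im_submod f) := Sub (f (repr q)) (fim (repr q)).
have fpi x : f (repr (pi x)) = f x by apply/fE; rewrite reprE.
have g_zmod : zmod_morphism g.
  move=> p q; apply: val_inj; apply: etrans (esym (raddfB val _ _)).
  rewrite -[p]reprE -[q]reprE /= 2!fpi.
  rewrite -linearB; apply/fE; rewrite [LHS]reprE; apply: (addIr (pi (repr q))).
  by rewrite subrK -[RHS]pi_quotD subrK.
have g_scal : scalable g.
  move=> a p; apply: val_inj; rewrite [RHS]linearZ.
  exact: etrans (fpi (a *: repr p)) (linearZZ f a (repr p)).
pose gz := GRing.isZmodMorphism.Build _ _ g g_zmod.
pose gs := GRing.isScalable.Build _ _ _ _ g g_scal.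
exists (HB.pack_for {linear quot_mod K -> submod_type (im_submod f)} g gz gs).
have ex (y : submod_type (im_submod f)) : exists x, f x = val y.
  by have := valP y; rewrite inE => /asboolP.
exists (fun y => pi (projT1 (cid (ex y)))) => [q|y] /=.
  rewrite -[RHS]reprE; apply/fE; exact: (projT2 (cid (ex (g q)))).
by apply: val_inj; apply: etrans (fpi _) (projT2 (cid (ex y))).
Qed.

End Modules.

(** The m of the theorem is [m.+1] here, so that [im m] is the image of gamma_(m-1). *)
Theorem corollary6p11 (F : fieldType) (e n : nat) (kappa1 kappa2 : 'Z_e)
    (he : (3 <= e)%N) (hn : (1 <= n)%N)
    (hkappa : kappa2 <> kappa1 - 1)
    (hmod : n%:R = kappa2 - kappa1 + 1 :> 'Z_e)
    (m : nat) (hm : (m.+1 <= n.-1)%N) :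
  let im k := im_submod (gamma F n kappa1 kappa2 k) in
  composition_series
    [:: zero_submod (specht F n kappa1 kappa2 m.+1);
        im m;
        full_submod (specht F n kappa1 kappa2 m.+1)]
  /\ exists f : {linear quot_mod (im m) -> submod_type (im m.+1)}, bijective f.
Proof.
move=> im.
have mn2 : (m.+1 < n)%N by rewrite -(prednK hn) ltnS.
have mn1 : (m < n)%N by apply: ltnW.
have [rho [rho_e rho_y rho_psi rho_scal]] := @cyclo_rep F e n kappa1 kappa2 he hkappa hmod.
have th k : (k <= n)%N -> _ :=
  @theta_exists F e n kappa1 kappa2 he hn hkappa hmod rho rho_e rho_y rho_psi k.
have [th0 th0E] := th m (ltnW mn1).
have [th1 th1E] := th m.+1 mn1.
have [th2 th2E] := th m.+2 mn2.
have imP := im_gammaP he hn hkappa hmod rho_e rho_y rho_psi rho_scal mn1 th0E th1E.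
have imP2 := im_gammaP he hn hkappa hmod rho_e rho_y rho_psi rho_scal mn2 th1E th2E.
have ker := gamma_eq0 he hn hkappa hmod rho_e rho_y rho_psi rho_scal mn2 th1E th2E.
have gam_ker x : x \in im m <-> gamma F n kappa1 kappa2 m.+1 x = 0.
  by rewrite imP ker.
have simp0 (W : submodule _) x := simple_core he (hn := hn) hkappa hmod
  rho_e rho_y rho_psi rho_scal mn1 th1E (U := W) (x := x).
have simp1 (W : submodule _) x := simple_core he (hn := hn) hkappa hmod
  rho_e rho_y rho_psi rho_scal mn2 th2E (U := W) (x := x).
have im_sub := im_gamma_sub he hn hkappa hmod rho_e rho_y rho_psi rho_scal mn1 th1E.
split; last exact: first_isomorphism.
split=> // -[|[|i]] // _ /=; split.
- by move=> x; rewrite inE => /eqP->; apply/gam_ker; rewrite raddf0.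
- apply: simple_factorP => [x||W x _ Wx /imP xl x0].
  + by rewrite inE => /eqP->; apply/gam_ker; rewrite raddf0.
  + exists (hook_v F n kappa1 kappa2 m).
      apply/imP; rewrite (th_hook_v he hn rho_psi mn1 th1E).
      exact: ends_leg_Gam.
    by rewrite inE (hook_v_neq0 he hn rho_psi mn1 th1E).
  + have xn0 : x != 0 by move: x0; rewrite inE.
    exact: im_sub (simp0 W x Wx xn0 xl).
- by [].
- apply: simple_factorP => [//||W x imW Wx _ xim].
    (* The generator is the word L...LA...A, which ends in A because [m.+1] is less than n. *)
    exists (specht_gen F n kappa1 kappa2 m.+1) => //; apply/negP => /imP zl.
    have := zl (hookw n m.+1); rewrite -[specht_gen _ _ _ _ _]scale1r th1E.
    rewrite rmorph1 mul1mx coef_basis eqxx ffunE /= => H.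
    have /H/eqP : ~~ (n.-1 < m.+1)%N by rewrite -leqNgt.
    by rewrite oner_eq0.
  (* The quotient is the image of the next gamma, so W is pushed forward: its image is nonzero and
     therefore contains the image of the generator. *)
  have gW_closed : GRing.submod_closed [pred y : specht F n kappa1 kappa2 m.+2 |
      `[< exists2 u, u \in W & gamma F n kappa1 kappa2 m.+1 u = y >]].
    split=> [|a u v]; rewrite !inE.
      by apply/asboolP; exists 0; rewrite ?rpred0 // raddf0.
    move=> /asboolP[u' Wu <-] /asboolP[v' Wv <-]; apply/asboolP.
    by exists (a *: u' + v'); rewrite ?rpredD ?rpredZ // linearP.
  have gx : gamma F n kappa1 kappa2 m.+1 x \in Submodule gW_closed.
    by rewrite inE; apply/asboolP; exists x.
  have gx0 : gamma F n kappa1 kappa2 m.+1 x != 0.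
    by apply: contraNneq xim => /gam_ker.
  have gxl : ends_leg hn (th2 (gamma F n kappa1 kappa2 m.+1 x)).
    by apply/imP2; rewrite inE; apply/asboolP; exists x.
  have := simp1 (Submodule gW_closed) _ gx gx0 gxl.
  rewrite inE => /asboolP[u Wu uE] y _.
  (* The generator and [u] have the same image, so they differ by an element of the kernel, which is
     [im m] and lies in W. *)
  have Wz : specht_gen F n kappa1 kappa2 m.+1 \in W.
    rewrite -[specht_gen _ _ _ _ _](subrK u) rpredD //; apply: imW; apply/gam_ker.
    rewrite linearB uE (gammaE he hn hkappa hmod rho_e rho_y rho_psi rho_scal mn2 th2E).
    exact: subrr.
  have [a ->] := specht_genE y; exact: rpredZ.
Qed.
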